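(* Let $G$ be a finite soluble group with trivial center. (i) If $\vec\Delta_{\rm norm}(G)$ is strongly connected, then the diameter of $\vec\Delta_{\rm norm}(G)$ is at most $8$. (ii) If $\vec \Delta_{\rm norm} (G)$ is strongly disconnected, then the number of strongly connected components of $\vec \Delta_{\rm norm} (G)$ is $|\mathrm{Fit}(G)|+1$; moreover, one strongly connected component has diameter at most $6$ and all other strongly connected components have diameter at most $2$.
   Context: For a group $G$ and $x,y\in G$, write $x\to y$ if $\langle x\rangle$ is normal in $\langle x,y\rangle$ (equivalently, $y$ normalizes $\langle x\rangle$), and $x\leftrightarrow y$ if both $x\to y$ and $y\to x$. The directed normalizing graph $\vec\Gamma_{\rm norm}(G)$ is the simple directed graph with vertex set $G$ and with an arc from $x$ to $y$ ($x\neq y$) whenever $x\to y$. $\mathrm{Univ}(G)$ is the set of those $x\in G$ with $x\leftrightarrow y$ for all $y\in G$. $\vec\Delta_{\rm norm}(G)$ is the induced subgraph of $\vec\Gamma_{\rm norm}(G)$ on $G\setminus\mathrm{Univ}(G)$. A directed graph is strongly connected if for every ordered pair of vertices $(u,v)$ there is a directed path from $u$ to $v$, and strongly disconnected otherwise; a strongly connected component is a maximal strongly connected subgraph. The diameter of a strongly connected directed graph is the supremum, over ordered pairs of distinct vertices $(u,v)$, of the length of a shortest directed path from $u$ to $v$. $\mathrm{Fit}(G)$ is the Fitting subgroup of $G$. *)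

(* Defs.v *)
From HB Require Import structures.
From mathcomp Require Import all_boot all_fingroup all_solvable.
Set Implicit Arguments. Unset Strict Implicit. Unset Printing Implicit Defensive.
Local Open Scope group_scope.

Section Digraph.
Variable T : finType.

Record digraph := Digraph {
  vertices : {set T};
  darc : rel T;
  darc_vertices : forall x y, darc x y -> x \in vertices /\ y \in vertices;
  darc_loopless : forall x, ~~ darc x x }.

Implicit Types (D : digraph) (A C : {set T}) (u v : T) (n : nat).

Definition induced_arc D A : rel T :=
  [rel x y | [&& x \in A, y \in A & darc D x y]].

Lemma induced_arc_vertices D A x y :
  induced_arc D A x y -> x \in vertices D :&: A /\ y \in vertices D :&: A.
Proof.
case/and3P=> Ax Ay /darc_vertices[Dx Dy].
by rewrite !inE Ax Ay Dx Dy.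
Qed.

Lemma induced_arc_loopless D A x : ~~ induced_arc D A x x.
Proof. by rewrite /induced_arc /= (negbTE (darc_loopless D x)) !andbF. Qed.

Definition induced D A : digraph :=
  Digraph (@induced_arc_vertices D A) (@induced_arc_loopless D A).

Definition strongly_connected D : bool :=
  [forall u in vertices D, forall v in vertices D, connect (darc D) u v].

Definition has_dipath D n u v : bool :=
  [exists p : n.-tuple T, path (darc D) u p && (last u p == v)].

(* A shortest directed path has fewer than #|T| arcs, so it suffices to search
   the lengths below #|T|; the default value #|T| means that v cannot be
   reached from u. *)
Definition distance D u v : nat :=
  find (fun n => has_dipath D n u v) (iota 0 #|T|).

(* The supremum over an empty set of pairs is 0: a digraph with at most one
   vertex has diameter 0. *)
Definition diameter D : nat :=
  \max_(u in vertices D) \max_(v in vertices D | u != v) distance D u v.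

(* A maximal strongly connected subgraph is an induced subgraph, so components
   are given by their vertex sets. *)
Definition strong_components D : {set {set T}} :=
  [set C | maxset [pred A : {set T} | [&& A != set0, A \subset vertices D
                                        & strongly_connected (induced D A)]] C].

End Digraph.

Section NormalizingGraph.
Variable gT : finGroupType.
Implicit Types (G : {group gT}) (x y : gT).

Definition normalizing x y : bool := <[x]> <| <<[set x; y]>>.

Definition norm_arc G : rel gT :=
  [rel x y | [&& x \in G, y \in G, x != y & normalizing x y]].

Lemma norm_arc_vertices G x y : norm_arc G x y -> x \in G /\ y \in G.
Proof. by case/and4P. Qed.

Lemma norm_arc_loopless G x : ~~ norm_arc G x x.
Proof. by rewrite /norm_arc /= eqxx !andbF. Qed.

Definition norm_digraph G : digraph gT :=
  Digraph (@norm_arc_vertices G) (@norm_arc_loopless G).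

Definition Univ G : {set gT} :=
  [set x in G | [forall y in G, normalizing x y && normalizing y x]].

Definition reduced_norm_digraph G : digraph gT :=
  induced (norm_digraph G) (G :\: Univ G).

End NormalizingGraph.

(* Main.v *)
(* Write F = Fit(G) and x -> y when y normalizes <x>.  An element having a
   nontrivial power s with C_F(s) <> 1 is joined in both directions to F by
   paths of length 2 through s, and any two nontrivial elements of F are at
   distance at most 2 through Z(F).  So only the elements u with <u> acting
   semiregularly on F ("fixfree" below) matter.  If such a u commutes with some
   y <> 1, and y with some t having a fixed point f on F, then u - y - t - f
   joins u to F in both directions.  If all fixfree elements reach F and are
   reached from F in at most 3 steps, the diameter is at most 3 + 2 + 3.

   If no such y and t exist for some fixfree u, then F has a complement H
   containing a conjugate of u, all O_r(H) act semiregularly on F, and for the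
   smallest prime q dividing |Fit(H)| and a normal subgroup <y> of order q of H,
   K = C_H(y) consists of 1 and all fixfree elements of H.  If K = H (G is a
   Frobenius group), no arc leaves K \ 1.  If K <> H, all subgroups of prime
   order of K are normal in H, hence K reaches F through H \ K, and a single arc
   into K \ 1 from outside gives paths of length 3 from F to all of K \ 1.
   So either the graph is strongly connected, or its components are the sets
   K^f \ 1 for f in F, of diameter at most 2 because y is central in K, and the
   set of nontrivial elements which are not fixfree. *)

Require Import Defs.
From mathcomp Require Import all_boot all_fingroup all_solvable.
From mathcomp Require Import all_algebra all_character.
Set Implicit Arguments. Unset Strict Implicit. Unset Printing Implicit Defensive.
Import FiniteModule.
Local Open Scope group_scope.

(** * Semiregular and coprime actions on soluble groups *)

(** A minimal [A]-invariant subgroup of [V] is an irreducible module for [A], faithful by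
    semiregularity; an abelian group with a faithful irreducible representation is cyclic. *)
Lemma semiregular_abelian_cyclic (gT : finGroupType) (V A : {group gT}) :
    solvable V -> V :!=: 1 -> A \subset 'N(V) -> abelian A ->
    semiregular V A -> cyclic A.
Proof.
move=> solV ntV nVA abA regVA.
have [M minM sMV] := minnormal_exists ntV nVA.
have [nMA ntM /is_abelemP[p _ abelM]] := minnormal_solvable minM sMV solV.
apply: (mx_faithful_irr_abelian_cyclic (rG := abelem_repr abelM ntM nMA)) => //.
  apply: abelem_mx_faithful; apply/trivgP/subsetP=> a /setIP[Aa cMa].
  apply: contraR ntM => nta; rewrite -subG1.
  have Aa1 : a \in A^# by apply/setD1P; rewrite in_set1 in nta.
  by rewrite -(regVA a Aa1) subsetI sMV -cent_cycle centsC cycle_subG.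
exact/abelem_mx_irrP.
Qed.

(* The elements of a Frobenius group are partitioned by its kernel and the
   conjugates of its complement, and a sum over a subgroup without fixed points
   vanishes; so the number of these conjugates, which divides [#|L|], kills
   every [v] in [[~: V, L]]. *)
Lemma abelian_Frobenius_ker_cent (gT : finGroupType) (G V L X : {group gT}) :
    [Frobenius G = L ><| X] -> G \subset 'N(V) -> abelian V ->
    coprime #|V| #|L| -> 'C_V(X) = 1 -> L \subset 'C(V).
Proof.
move=> frobG nVG abV coVL cVX1.
have [/sdprod_context[nsLG sXG _ nLX _] ntL ntX _ _] := Frobenius_context frobG.
have sLG := normal_sub nsLG; have nVL := subset_trans sLG nVG.
rewrite centsC (sameP commG1P trivgP).
have cW1 := coprime_abel_cent_TI nVL coVL abV; set W := [~: V, L] in cW1 *.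
have sWV : W \subset V by rewrite commg_subl.
have nWG : G \subset 'N(W) by apply: normsR => //; apply: normal_norm.
apply/subsetP=> v Wv; have Vv := subsetP sWV v Wv.
(* The sum of the conjugates of [v] under [B], taken in the additive copy of [V]; it is fixed by [B]
   when [B] is a subgroup. *)
pose tr (B : {set gT}) := (\sum_(b in B) fmod abV v ^@ b)%R.
have trJ (B : {group gT}) b :
  B \subset G -> b \in B -> val (tr B) ^ b = val (tr B).
  move=> sBG Bb; have nVb := subsetP (subset_trans sBG nVG) b Bb.
  rewrite -fmvalJ // actr_sum; congr val;
    rewrite /tr [RHS](reindex_inj (mulIg b)).
  apply: eq_big => [c | c Bc]; first by rewrite groupMr.
  by rewrite actrM // (subsetP nVG) // (subsetP sBG).
have tr0 (B : {group gT}) : B \subset G -> 'C_V(B) = 1 -> tr B = 0%R.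
  move=> sBG cVB1; apply: val_inj; apply/set1gP; rewrite -cVB1 inE fmodP.
  by apply/centP=> b Bb; apply/commgP/conjg_fixP; apply: trJ.
have trW (B : {group gT}) : B \subset G -> val (tr B) \in W.
  move=> sBG; rewrite -[val _]/(fmval _) fmval_sum; apply: group_prod => b Bb.
  have Gb := subsetP sBG b Bb.
  by rewrite fmvalJ ?fmodK ?(subsetP nVG) // memJ_norm ?(subsetP nWG).
have trL : tr L = 0%R.
  apply: val_inj; apply/set1gP; rewrite -cW1 inE trW //.
  by apply/centP=> b Bb; apply/commgP/conjg_fixP; apply: trJ.
have trG : tr G = 0%R.
  apply: val_inj; apply/set1gP; rewrite -cW1 inE trW //.
  by apply/centP=> b Lb; apply/commgP/conjg_fixP; apply: trJ => //;
    apply: (subsetP sLG).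
have trX y : y \in G -> tr (X :^ y) = 0%R.
  move=> Gy; apply: tr0; first by rewrite conj_subG.
  by rewrite -(normsP nVG y Gy) centJ -conjIg cVX1 conjs1g.
have partG := Frobenius_partition frobG.
have : tr G = 0%R by [].
rewrite {1}/tr (set_partition_big _ partG) /=.
rewrite big_setU1 /=; last first.
  apply/negP=> /imsetP[y Ly defL]; have : 1 \in L by [].
  by rewrite defL mem_conjg conj1g !inE eqxx.
(* Since [tr (X :^ y)] vanishes and its term at 1 is [v], each set [X^# :^ y] contributes [- v]. *)
rewrite -/(tr L) trL GRing.add0r (eq_bigr (fun=> - fmod abV v)%R); last first.
  move=> _ /imsetP[y Ly ->]; apply/eqP; rewrite -GRing.addr_eq0; apply/eqP.
  have := trX y (subsetP sLG y Ly);
    rewrite /tr (big_setD1 1) //= actr1 GRing.addrC.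
  by rewrite conjD1g.
rewrite GRing.sumr_const GRing.mulNrn => /eqP; rewrite GRing.oppr_eq0 => /eqP.
move/(congr1 val); rewrite fmvalZ fmodK //= => vL1.
have /(coprime_dvdr)-/(_ _ coVL) coVX : #|X^# :^: L| %| #|L|
  by rewrite card_conjugates dvdn_indexg.
by apply/set1gP; rewrite -(expgK coVX Vv) vL1 expg1n.
Qed.

Lemma prime_regular_coprime (gT : finGroupType) (V X : {group gT}) :
  X \subset 'N(V) -> prime #|X| -> 'C_V(X) = 1 -> coprime #|V| #|X|.
Proof.
move=> nVX prX cVX1; apply: regular_norm_coprime => // x /setD1P[ntx Xx].
apply/trivgP; rewrite -cVX1 setIS //= -cent_cycle centS //.
by rewrite prime_meetG // (setIidPr _) ?cycle_eq1 ?cycle_subG.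
Qed.

(** Induction on [#|V|]: [L] centralizes the derived subgroup [D] of [V] by induction, and [V / D]
    because [L] and [X] induce a Frobenius group on this abelian quotient. Coprimeness gives
    [V = D * 'C_V(L)]. *)
Lemma regular_prime_cent (gT : finGroupType) (V L X : {group gT}) :
    solvable V -> X \subset 'N(V) -> X \subset 'N(L) -> L \subset 'N(V) ->
    prime #|X| -> coprime #|V| #|L| -> 'C_V(X) = 1 -> 'C_L(X) = 1 ->
  L \subset 'C(V).
Proof.
have [n] := ubnP #|V|; elim: n => // n IHn in gT V L X *.
move=> /ltnSE-leVn solV nVX nLX nVL prX coVL cVX1 cLX1.
have [-> | ntV] := eqsVneq V 1; first by rewrite cents1.
have [-> | ntL] := eqsVneq L 1; first by rewrite sub1G.
pose D := V^`(1)%G; have sDV : D \subset V := der_sub 1 V.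
have prDV : D \proper V := sol_der1_proper solV (subxx V) ntV.
have [nDX nDL] : X \subset 'N(D) /\ L \subset 'N(D) by rewrite !gFnorm_trans.
have coVX := prime_regular_coprime nVX prX cVX1.
have coLX := prime_regular_coprime nLX prX cLX1.
have cDX1 : 'C_D(X) = 1 by apply/trivgP; rewrite -cVX1 setSI.
have cDL : L \subset 'C(D).
  apply: (IHn _ D L X); rewrite ?(solvableS sDV) ?(coprimeSg sDV) //.
  exact: leq_trans (proper_card prDV) leVn.
have tiDX : D :&: X = 1 by rewrite coprime_TIg ?(coprimeSg sDV).
have tiDL : D :&: L = 1 by rewrite coprime_TIg ?(coprimeSg sDV).
have tiXD : X :&: D = 1 by rewrite setIC.
have prXD : prime #|X / D| by rewrite -(card_isog (quotient_isog nDX tiDX)).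
have cLXD : 'C_(L / D)(X / D) = 1.
  by rewrite -quotient_TI_subcent // ?cLX1 ?quotient1 // setIC.
have frob : [Frobenius (L / D) <*> (X / D) = (L / D) ><| (X / D)].
  apply/prime_FrobeniusP => //.
    by rewrite -cardG_gt1 -(card_isog (quotient_isog nDL tiDL)) cardG_gt1.
  split=> //; rewrite sdprodEY ?quotient_norms //.
  by rewrite coprime_TIg // coprime_morph.
have cVLD : L / D \subset 'C(V / D).
  apply: abelian_Frobenius_ker_cent frob _ _ _ _.
  - by rewrite join_subG !quotient_norms.
  - exact: sub_der1_abelian.
  - by rewrite coprime_morph.
  - by rewrite -coprime_quotient_cent // cVX1 quotient1.
have defV : V \subset D * 'C_V(L).
  rewrite -quotientSK ?(subset_trans sDV) ?gFnorm //.
  by rewrite coprime_quotient_cent // subsetI subxx centsC.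
rewrite centsC (subset_trans defV) // mul_subG ?subsetIr //.
by rewrite centsC.
Qed.

(** By coprimeness [X] has no fixed points in [[~: A, X]], so this commutator centralizes [V]; it is
    trivial since [A] acts faithfully. *)
Lemma coprime_abelian_cent (gT : finGroupType) (V A X : {group gT}) :
    solvable V -> X \subset 'N(V) -> X \subset 'N(A) -> A \subset 'N(V) ->
    prime #|X| -> coprime #|V| #|A| -> coprime #|A| #|X| -> abelian A ->
    'C_V(X) = 1 -> 'C_A(V) = 1 ->
  X \subset 'C(A).
Proof.
move=> solV nVX nAX nVA prX coVA coAX abA cVX1 cAV1.
have sBA : [~: A, X] \subset A by rewrite commg_subl.
rewrite centsC; apply/commG1P/trivgP; rewrite -cAV1 subsetI sBA /=.
apply: (@regular_prime_cent _ V [~: A, X]%G X) => //.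
- by rewrite normsRr.
- exact: subset_trans nVA.
- by rewrite (coprimegS _ coVA).
exact: coprime_abel_cent_TI.
Qed.

(** Otherwise some normal subgroup [M] of [G] inside [C], not contained in ['F(G)], has an
    elementary abelian quotient by the subgroup [C :&: 'F(G)], which is central in [M]. Then [M] is
    nilpotent, hence contained in ['F(G)]. *)
Lemma cent_sub_Fitting (gT : finGroupType) (G : {group gT}) :
  solvable G -> 'C_G('F(G)) \subset 'F(G).
Proof.
move=> solG; apply: contraT => not_sCF; have nsFG := Fitting_normal G.
set C := 'C_G('F(G)) in not_sCF.
have nsCG : C <| G by rewrite /normal subsetIl normsI ?normG ?norms_cent
  ?gFnorm.
have nsZ : C :&: 'F(G) <| G by apply: normalI.
have nZG := normal_norm nsZ.
have ntCZ : C / (C :&: 'F(G)) != 1.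
  rewrite -subG1 quotient_sub1 ?(subset_trans (normal_sub nsCG) nZG) //.
  by rewrite subsetI subxx.
have [|Mb [sMC nsM ntM abM]] :=
  @solvable_norm_abelem _ (G / (C :&: 'F(G))) (C / (C :&: 'F(G)))
    _ (quotient_normal _ nsCG) ntCZ.
  by rewrite quotient_sol // (solvableS (normal_sub nsCG)).
have [M defM sZM nsMG] := inv_quotientN nsZ nsM.
have sMC' : M \subset C.
  move: sMC; rewrite defM quotientSGK ?subsetIl //.
  exact: subset_trans (normal_sub nsMG) nZG.
have cZM : M :&: 'F(G) \subset 'Z(M).
  rewrite subsetI subsetIl centsC; apply: subset_trans sMC' _.
  by rewrite (subset_trans (subsetIr _ _)) ?centS ?subsetIr.
case/negP: ntM; rewrite defM -subG1 quotient_sub1; last first.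
  exact: subset_trans (normal_sub nsMG) nZG.
rewrite subsetI sMC' Fitting_max // -quotient_center_nil abelian_nil //.
have [p _ /abelem_abelian abMb] := is_abelemP abM.
have sZZ : C :&: 'F(G) \subset 'Z(M).
  by rewrite (subset_trans _ cZM) // subsetI sZM subsetIr.
rewrite /abelian quotient_cents2 ?normal_norm ?center_normal //.
apply: subset_trans sZZ; rewrite -quotient_cents2 -?defM //.
  exact: subset_trans (normal_sub nsMG) nZG.
exact: subset_trans (normal_sub nsMG) nZG.
Qed.

(** * Actions on [r]-groups, and commuting [r]-elements *)

Lemma Fp_primitive_root (r p : nat) : prime r -> prime p -> p %| r.-1 ->
  exists z : 'F_r, p.-primitive_root%R z.
Proof.
move=> r_pr p_pr p_dv.
have [|a _ oa] := @Cauchy _ p [set: {unit 'F_r}]%G p_pr.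
  by rewrite /= card_finField_unit card_Fp.
have ap1 : (FinRing.uval a ^+ p = 1)%R.
  by rewrite -FinRing.val_unitX -oa expg_order.
have [m prim_m m_dv] := prim_order_exists (prime_gt0 p_pr) ap1.
have [/eqP m1 | m_neq1] := boolP (m == 1%N).
  have a1 : a = 1 by apply: val_inj; have := prim_expr_order prim_m;
    rewrite m1 GRing.expr1.
  by move: p_pr; rewrite -oa a1 order1.
exists (FinRing.uval a); rewrite (_ : p = m) //; apply/esym/eqP.
by case/primeP: p_pr => _ /(_ m m_dv); rewrite (negPf m_neq1).
Qed.

(** The [p]-th roots of unity lie in ['F_r], which therefore splits the abelian group [X]: the
    irreducible module [V] has dimension 1. *)
Lemma card_minnormal_abelem (gT : finGroupType) (p r : nat) (V X : {group gT}) :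
    prime r -> prime p -> p %| r.-1 -> #|X| = p -> r.-abelem V ->
    minnormal V X ->
  #|V| = r.
Proof.
move=> r_pr p_pr p_dv oX abelV minV.
have [/andP[ntV nVX] _] := mingroupP minV.
have [z prim_z] := Fp_primitive_root r_pr p_pr p_dv.
have abX : abelian X by rewrite cyclic_abelian ?prime_cyclic ?oX.
have splitX : group_splitting_field 'F_r X.
  by apply: primitive_root_splitting_abelian abX; rewrite oX; apply: prim_z.
have /(abelem_mx_irrP abelV ntV nVX) irrV := minV.
have dim1 := mx_irr_abelian_linear splitX irrV abX.
by rewrite (card_pgroup (abelem_pgroup abelV)) -(dim_abelemE abelV ntV)
  dim1 expn1.
Qed.

(** By coprimeness ['C_Q(X)] covers [Q / 'Phi(Q)], so it generates [Q] together with the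
    non-generators ['Phi(Q)]. *)
Lemma coprime_cent_Phi (gT : finGroupType) (p : nat) (Q X : {group gT}) :
    p.-group Q -> X \subset 'N(Q) -> coprime #|Q| #|X| ->
    X / 'Phi(Q) \subset 'C(Q / 'Phi(Q)) ->
  X \subset 'C(Q).
Proof.
move=> pQ nQX coQX cQX; have nPhiX : X \subset 'N('Phi(Q))
  by apply: gFnorm_trans.
have solQ := nilpotent_sol (pgroup_nil pQ).
have : Q \subset 'Phi(Q) * 'C_Q(X).
  rewrite -quotientSK ?gFnorm // coprime_quotient_cent ?Phi_sub //.
  by rewrite subsetI subxx centsC.
move=> defQ; have defC : <<'C_Q(X)>> = Q.
  apply: Phi_nongen; apply/eqP; rewrite eqEsubset join_subG Phi_sub subsetIl /=.
  by rewrite (subset_trans defQ) // mul_subG ?joing_subl ?joing_subr.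
by rewrite centsC -defC genGid subsetIr.
Qed.

(* In a minimal [X]-invariant subgroup [M] not centralized by [X], the quotient
   [M / 'Phi(M)] has order [r], because 'F_r contains the [p]-th roots of unity;
   thus [M] is cyclic. *)
Lemma coprime_cent_pgroup_pred (gT : finGroupType) (p r : nat)
    (Q X : {group gT}) :
    prime r -> prime p -> p %| r.-1 -> #|X| = p -> r.-group Q ->
    X \subset 'N(Q) ->
    (forall A : {group gT},
       A \subset Q -> X \subset 'N(A) -> abelian A -> X \subset 'C(A)) ->
  X \subset 'C(Q).
Proof.
move=> r_pr p_pr p_dv oX rQ nQX cAX; apply: contraT => ncQX.
have coQX (A : {group gT}) : r.-group A -> coprime #|A| #|X|.
  move=> rA; rewrite oX (pnat_coprime rA) // pnatE // !inE.
  apply: contraTneq p_dv => ->; rewrite gtnNdvd //.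
    by rewrite -ltnS prednK ?prime_gt1 ?prime_gt0.
  by rewrite prednK ?prime_gt0.
have [M /mingroupP[/andP[nMX ncMX] minM] sMQ] :
    {M : {group gT} | [min M | (X \subset 'N(M))
      && ~~ (X \subset 'C(M))] & M \subset Q}.
  by apply: mingroup_exists; rewrite nQX.
have rM := pgroupS sMQ rQ.
case/negP: (ncMX); apply: cAX => //; apply: cyclic_abelian.
apply: Phi_quotient_cyclic; set Mb := M / _.
have nPhiX : X \subset 'N('Phi(M)) by apply: gFnorm_trans.
have nMbX : X / 'Phi(M) \subset 'N(Mb) by apply: quotient_norms.
have coMX := coQX M rM.
have tiPX : X :&: 'Phi(M) = 1
  by rewrite setIC coprime_TIg ?(coprimeSg (Phi_sub M)).
have oXb : #|X / 'Phi(M)| = p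
  by rewrite -(card_isog (quotient_isog nPhiX _)) // setIC.
have coMbX : coprime #|Mb| #|X / 'Phi(M)| by rewrite coprime_morph.
have abelM : r.-abelem Mb := Phi_quotient_abelem rM.
have ntR : [~: Mb, X / 'Phi(M)] != 1.
  apply: contraNneq ncMX => R1; apply: (coprime_cent_Phi rM nMX coMX).
  by rewrite centsC; apply/commG1P.
have sRM : [~: Mb, X / 'Phi(M)] \subset Mb by rewrite commg_subl.
have nRX : X / 'Phi(M) \subset 'N([~: Mb, X / 'Phi(M)]) by apply: normsRr.
(* Taking [Wb] inside the commutator, where [X] has no fixed points, ensures that [X] does not
   centralize it; the minimality of [M] then forces [Wb = Mb]. *)
have [Wb minW sWR] := minnormal_exists ntR nRX.
have [/andP[ntW nWX] _] := mingroupP minW.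
have sWM := subset_trans sWR sRM.
have oW : #|Wb| = r by apply: card_minnormal_abelem oXb (abelemS sWM abelM)
  minW.
have ncW : ~~ (X / 'Phi(M) \subset 'C(Wb)).
  apply: contra ntW => cWX; rewrite -subG1.
  rewrite -(coprime_abel_cent_TI nMbX coMbX (abelem_abelian abelM)).
  by rewrite subsetI sWR centsC.
have [W defW sPW sWM'] := inv_quotientS (Phi_normal M) sWM.
suff defM : W :=: M by have -> : Mb = Wb by [rewrite defW defM];
  rewrite prime_cyclic ?oW.
apply: minM => //; apply/andP; split.
  rewrite -(quotientSGK nPhiX) ?(subset_trans sPW (normG W)) //.
  have nsPW : 'Phi(M) <| W by apply: normalS (Phi_normal M).
  by rewrite quotient_normG //; have -> : W / 'Phi(M) = Wb by rewrite defW.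
apply: contra ncW => cWX; rewrite defW; exact: quotient_cents.
Qed.

(* If [r != #[x]] and [x] fixed no nontrivial element of an invariant Sylow
   [r]-subgroup of [E], this subgroup would centralize 'O_r^'('F(G)), and [E]
   would be nilpotent. *)
Lemma commuting_pelt_exists (gT : finGroupType) (G E : {group gT})
    (x : gT) (r : nat) :
    solvable G -> x \in G -> prime #[x] -> 'C_('F(G))[x] = 1 ->
    E <| G -> 'F(G) \subset E -> ~~ (E \subset 'F(G)) -> r.-group (E / 'F(G)) ->
  exists t, [/\ t \in E, t \in 'C[x], t != 1 & r.-elt t].
Proof.
move=> solG Gx prx cFx1 nsEG sFE not_sEF rEF; have [sEG nEG] := andP nsEG.
have nsFG := Fitting_normal G; have nFG := normal_norm nsFG.
have solE := solvableS sEG solG.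
(* If [r = #[x]], a Sylow [r]-subgroup [P] of [G] containing [x] meets [E] in a nontrivial normal
   subgroup of [P], which contains a nontrivial central element of [P]. *)
have [def_r | neq_rp] := eqVneq r #[x].
  have [P sylP sxP] : {P : {group gT} | r.-Sylow(G) P & <[x]> \subset P}.
    by apply: Sylow_superset; rewrite ?cycle_subG // /pgroup def_r pnat_id.
  have sylPE := Sylow_setI_normal nsEG sylP; have rP := pHall_pgroup sylP.
  have ntPE : P :&: E != 1.
    apply: contraNneq not_sEF => PE1.
    have r'E : r^'.-group E.
      by rewrite /pgroup -partn_eq1 // -(card_Hall sylPE) /= setIC PE1 cards1.
    rewrite -quotient_sub1 ?(subset_trans sEG) // subG1.
    exact/eqP/card1_trivg/(pnat_1 rEF)/quotient_pgroup.
  have nsPE : P :&: E <| P by rewrite /normal subsetIl normsI ?normG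
    ?(subset_trans (pHall_sub sylP)).
  have := meet_center_nil (pgroup_nil rP) nsPE ntPE.
  case/trivgPn=> t /setIP[/setIP[Pt Et] /setIP[_ cPt]] ntt.
  exists t; split=> //; last exact: mem_p_elt rP Pt.
  by apply/cent1P; apply: (centP cPt); rewrite -cycle_subG.
have nFX : <[x]> \subset 'N('F(G)) by rewrite cycle_subG (subsetP nFG).
have nEX : <[x]> \subset 'N(E) by rewrite cycle_subG (subsetP nEG).
have cFX1 : 'C_('F(G))(<[x]>) = 1 by rewrite cent_cycle.
have coFX := prime_regular_coprime nFX prx cFX1.
have coEX : coprime #|E| #|<[x]>|.
  rewrite -(Lagrange sFE) coprimeMl coFX -card_quotient ?(subset_trans sEG) //.
  by rewrite (pnat_coprime rEF) // pnatE // !inE eq_sym.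
have [Q sylQ nQX] := sol_coprime_Sylow_exists r (abelian_sol (cycle_abelian
  x)) nEX coEX.
have [cQX1 | ] := eqVneq 'C_Q(<[x]>) 1; last first.
  case/trivgPn=> t /setIP[Qt cXt] ntt; exists t; split=> //.
  - exact: subsetP (pHall_sub sylQ) _ Qt.
  - by rewrite -cent_cycle.
  exact: mem_p_elt (pHall_pgroup sylQ) Qt.
pose R := 'O_r^'('F(G))%G; have nilF := Fitting_nil G.
have sRF : R \subset 'F(G) := pcore_sub _ _.
have nsRG : R <| G by rewrite gFnormal_trans.
have sQE := pHall_sub sylQ; have rQ := pHall_pgroup sylQ.
have coRQ : coprime #|R| #|Q|.
  by rewrite coprime_sym (pnat_coprime rQ) //; apply: pcore_pgroup.
have cRQ : Q \subset 'C(R).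
  apply: (@regular_prime_cent _ R Q <[x]>%G) => //.
  - exact: solvableS (subset_trans sRF sFE) solE.
  - by rewrite cycle_subG (subsetP (normal_norm nsRG)).
  - by rewrite (subset_trans sQE) // (subset_trans sEG) ?normal_norm.
  - by apply/trivgP; rewrite -cFX1 setSI.
have hallR : r^'.-Hall(E) R.
  rewrite /pHall (subset_trans sRF) // pcore_pgroup -(Lagrange_index sFE sRF)
    pnatM.
  rewrite pnatNK -card_quotient ?(subset_trans sEG) // [_.-nat _]rEF /=.
  by have /and3P[] := nilpotent_pcore_Hall r^' nilF.
have defE : R * Q = E.
  apply/eqP; rewrite eqEcard mul_subG ?(subset_trans sRF) //=.
  by rewrite coprime_cardMg // (card_Hall hallR) (card_Hall sylQ) mulnC partnC.
case/negP: not_sEF; apply: Fitting_max => //.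
by rewrite -defE mulg_nil // (nilpotentS sRF) // (pgroup_nil rQ).
Qed.

(** * Elements of prime power order, and a complement of the Fitting subgroup *)

(** [v] induces a nontrivial [p]-group of automorphisms on [<[y]>], whose automorphism group has
    order [#[y].-1]. *)
Lemma pelt_nonfix_prime (gT : finGroupType) (p : nat) (v y : gT) :
    p.-elt v -> prime #[y] -> v \in 'N(<[y]>) -> v \notin 'C[y] ->
  p %| #[y].-1.
Proof.
move=> pv pry nyv ncyv; have nYV : <[v]> \subset 'N(<[y]>)
  by rewrite cycle_subG.
have pf : p.-group (conj_aut <[y]> @* <[v]>) by apply: morphim_pgroup.
have ntf : conj_aut <[y]> @* <[v]> != 1.
  apply: contra ncyv; rewrite -subG1 sub_morphim_pre // => sVK.
  have : v \in 'ker (conj_aut <[y]>) by rewrite (subsetP sVK) ?cycle_id.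
  by rewrite ker_conj_aut cent_cycle.
have [_ p_dv _] := pgroup_pdiv pf ntf; apply: dvdn_trans p_dv _.
rewrite -(totient_prime pry) -card_Aut_cycle cardSg //.
exact: subset_trans (morphimS _ (subsetT _)) (Aut_conj_aut _ _).
Qed.

Lemma constt_notin (gT : finGroupType) (K : {group gT}) (w : gT) :
  w \notin K -> exists2 p, p \in \pi(#[w]) & w.`_p \notin K.
Proof.
move=> notKw.
have [/hasP[p pi_p nKp] | /hasPn sK] := boolP (has (fun p : nat =>
  w.`_p \notin K) (primes #[w])).
  by exists p.
case/negP: notKw; rewrite -(prod_constt w); apply: group_prod => p _.
have [/sK|p'w] := boolP (p \in primes #[w]); first by rewrite /= negbK.
rewrite (constt1P _) //; apply: sub_in_pnat (pnat_pi (order_gt0 w)) => l w_l _.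
by apply: contraNN p'w => /eqP <-.
Qed.

Lemma semiregular_pelt_p'group (gT : finGroupType) (p : nat)
    (F : {group gT}) (t : gT) :
    prime p -> t \in 'N(F) -> t != 1 -> p.-elt t -> semiregular F <[t]> ->
  p^'.-group F.
Proof.
move=> p_pr nFt ntt pt regFt.
have coFt : coprime #|F| #[t] by apply: regular_norm_coprime;
  rewrite ?cycle_subG.
rewrite /pgroup p'natE // -prime_coprime // coprime_sym (coprime_dvdr _ coFt)
  //.
by case: (pgroup_pdiv pt) => //; rewrite cycle_eq1.
Qed.

(** Let [E / 'F(G)] be a nontrivial normal elementary abelian [r]-subgroup of [G / 'F(G)]. An
    [r]-element [t] of [E] commuting with [x] acts without fixed points, so ['F(G)] is an
    [r^']-group and has a Sylow complement [Q] in [E]. The Frattini argument gives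
    [G = 'F(G) * 'N_G(Q)], and an element of ['F(G)] normalizing [Q] commutes with [t], hence is
    trivial. *)
Lemma Fitting_complement_exists (gT : finGroupType) (G : {group gT}) (x : gT) :
    solvable G -> x \in G -> prime #[x] -> semiregular 'F(G) 'C_G[x] ->
  exists H : {group gT}, 'F(G) ><| H = G.
Proof.
move=> solG Gx prx regFx; have nsFG := Fitting_normal G;
  have [sFG nFG] := andP nsFG.
have ntx : x != 1 by rewrite -order_gt1 prime_gt1.
have cFx1 : 'C_('F(G))[x] = 1 by apply: regFx; apply/setD1P;
  rewrite inE Gx cent1id.
have Fx : x \notin 'F(G).
  by apply: contra ntx => Fx; apply/eqP/set1gP; rewrite -cFx1 inE Fx cent1id.
have ntGF : G / 'F(G) != 1.
  by rewrite -subG1 quotient_sub1 //; apply: contra Fx => /subsetP->.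
have [Eb [_ nsEb ntE /is_abelemP[r r_pr abelE]]] :=
  solvable_norm_abelem (quotient_sol _ solG) (normal_refl _) ntGF.
have [E defE sFE nsEG] := inv_quotientN nsFG nsEb; have [sEG nEG] := andP nsEG.
have rEF : r.-group (E / 'F(G)) by rewrite -defE (abelem_pgroup abelE).
have not_sEF : ~~ (E \subset 'F(G)).
  by rewrite -quotient_sub1 ?(subset_trans sEG) // -defE subG1.
have [t [Et cxt ntt rt]] :=
  commuting_pelt_exists solG Gx prx cFx1 nsEG sFE not_sEF rEF.
have sTC : <[t]> \subset 'C_G[x] by rewrite cycle_subG inE (subsetP sEG).
have regFt : semiregular 'F(G) <[t]> by apply: semiregularS regFx.
have r'F : r^'.-group 'F(G).
  by apply: semiregular_pelt_p'group rt _ => //;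
    rewrite (subsetP nFG) ?(subsetP sEG).
have [Q sylQ sTQ] : {Q : {group gT} | r.-Sylow(E) Q & <[t]> \subset Q}.
  by apply: Sylow_superset; rewrite ?cycle_subG.
have [sQE rQ] := (pHall_sub sylQ, pHall_pgroup sylQ).
have coFQ : coprime #|'F(G)| #|Q| by rewrite coprime_sym (pnat_coprime rQ).
have hallF : r^'.-Hall(E) 'F(G).
  by rewrite /pHall sFE r'F pnatNK -card_quotient ?(subset_trans sEG).
have defE' : 'F(G) * Q = E.
  apply/eqP; rewrite eqEcard mul_subG //=.
  by rewrite coprime_cardMg // (card_Hall hallF) (card_Hall sylQ) mulnC partnC.
exists 'N_G(Q)%G; rewrite sdprodE /= ?subIset ?nFG //.
  have sQN : Q \subset 'N_G(Q) by rewrite subsetI normG (subset_trans sQE).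
  by rewrite -[RHS](Frattini_arg nsEG sylQ) -defE' -mulgA (mulSGid sQN).
apply/trivgP; rewrite /= -(regFt t); last by rewrite !inE ntt cycle_id.
apply/subsetP=> f /setIP[Ff /setIP[_ nQf]]; rewrite inE Ff /=.
have Qt : t \in Q by rewrite -cycle_subG.
have nFt : t \in 'N('F(G)) by rewrite (subsetP nFG) ?(subsetP sEG).
apply/cent1P/commgP/eqP/set1gP; rewrite -(coprime_TIg coFQ); apply/setIP; split.
  by rewrite commgEl groupMl ?groupV // memJ_norm.
by rewrite commgEr groupMr // memJ_norm ?groupV.
Qed.

(** * Semiregular subgroups, and the complement when an unlinked element exists *)

(** Elementary abelian subgroups of [Q] are cyclic, so [Q] has rank at most 1, and [Q] has odd
    order. *)
Lemma semiregular_pgroup_cyclic (gT : finGroupType) (F Q : {group gT})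
    (r : nat) :
    solvable F -> F :!=: 1 -> Q \subset 'N(F) -> semiregular F Q ->
    r.-group Q -> odd #|Q| -> cyclic Q.
Proof.
move=> solF ntF nFQ regFQ rQ oddQ; rewrite (odd_pgroup_rank1_cyclic rQ) //.
have [E /pnElemP[sEQ abelE <-]] := p_rank_witness r Q.
have cycE : cyclic E.
  apply: (semiregular_abelian_cyclic solF) => //; first exact: subset_trans nFQ.
    exact: abelem_abelian abelE.
  exact: semiregularS regFQ.
by rewrite -abelem_cyclic.
Qed.

(** The two elements generate an abelian, hence cyclic, semiregular group, which has at most one
    subgroup of each order. *)
Lemma semiregular_cycle_eq (gT : finGroupType) (F K : {group gT}) (x z : gT) :
    solvable F -> F :!=: 1 -> K \subset 'N(F) -> semiregular F K ->
    x \in K -> z \in K -> x \in 'C[z] -> #[x] = #[z] -> <[x]> = <[z]>.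
Proof.
move=> solF ntF nFK regFK Kx Kz czx eq_o.
have cxz : <[z]> \subset 'C(<[x]>) by rewrite cycle_subG /= cent_cycle cent1C.
have sxzK : <[x]> <*> <[z]> \subset K by rewrite join_subG !cycle_subG Kx.
have cyc : cyclic (<[x]> <*> <[z]>).
  apply: (semiregular_abelian_cyclic solF) => //; first exact: subset_trans nFK.
    by rewrite abelianY !cycle_abelian cxz.
  exact: semiregularS regFK.
by apply/eqP; rewrite (eq_subG_cyclic cyc)
  ?joing_subl ?joing_subr // -!orderE eq_o.
Qed.

(* No path u - y - t of commuting nontrivial elements of [G] ends at an element
   [t] having nontrivial fixed points on 'F(G). *)
Definition unlinked (gT : finGroupType) (G : {group gT}) (u : gT) : Prop :=
  {in 'C_G[u]^#, forall y, semiregular 'F(G) 'C_G[y]}.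

(** The normal subgroup ['F(G) <*> 'O_r(H)] contains a nontrivial [r]-element commuting with [x],
    and this element acts without fixed points on ['F(G)]. *)
Lemma pcore_complement_p'group (gT : finGroupType) (G H : {group gT})
    (x : gT) (r : nat) :
    solvable G -> 'F(G) ><| H = G -> x \in G -> prime #[x] ->
    semiregular 'F(G) 'C_G[x] -> 'O_r(H) != 1 ->
  r^'.-group 'F(G).
Proof.
move=> solG defG Gx prx regFx ntO; have nsFG := Fitting_normal G.
have [_ sHG defFH nFH tiFH] := sdprod_context defG; have [sFG nFG] := andP nsFG.
have ntx : x != 1 by rewrite -order_gt1 prime_gt1.
have cFx1 : 'C_('F(G))[x] = 1 by apply: regFx; apply/setD1P;
  rewrite inE Gx cent1id.
have sOH : 'O_r(H) \subset H := pcore_sub _ _; have sOG := subset_trans sOH sHG.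
have rO : r.-group 'O_r(H) := pcore_pgroup _ _.
pose E := ('F(G) <*> 'O_r(H))%G.
have sEG : E \subset G by rewrite join_subG sFG.
have sFE : 'F(G) \subset E := joing_subl _ _.
have nsEG : E <| G.
  rewrite /normal sEG -{1}defFH mul_subG //.
    exact: subset_trans sFE (normG E).
  by rewrite normsY // gFnorm.
have not_sEF : ~~ (E \subset 'F(G)).
  apply: contra ntO => sEF; rewrite -subG1 -tiFH subsetI sOH andbT.
  exact: subset_trans (joing_subr _ _) sEF.
have rEF : r.-group (E / 'F(G)).
  by rewrite /= joingC quotientYidr ?quotient_pgroup // (subset_trans sOH).
have [t [Et cxt ntt rt]] :=
  commuting_pelt_exists solG Gx prx cFx1 nsEG sFE not_sEF rEF.
have [r_pr _ _] := pgroup_pdiv rO ntO.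
apply: semiregular_pelt_p'group r_pr _ ntt rt _.
  by rewrite (subsetP nFG) // (subsetP sEG).
by apply: semiregularS regFx => //; rewrite cycle_subG inE (subsetP sEG).
Qed.

(** [A] acts faithfully on ['F(G)], because ['C_G('F(G))] lies in the [r^']-group ['F(G)]; so
    [coprime_abelian_cent] applies. *)
Lemma fixfree_cent_abelian (gT : finGroupType) (G A : {group gT})
    (x : gT) (r : nat) :
    solvable G -> x \in 'N_G(A) -> prime #[x] -> 'C_('F(G))[x] = 1 ->
    A \subset G -> r.-group A -> r != #[x] -> r^'.-group 'F(G) -> abelian A ->
  A \subset 'C[x].
Proof.
move=> solG /setIP[Gx nAx] prx cFx1 sAG rA neq_rx r'F abA.
have [sFG nFG] := andP (Fitting_normal G).
have coFA : coprime #|'F(G)| #|A| by rewrite coprime_sym (pnat_coprime rA).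
rewrite -cent_cycle centsC; apply: (@coprime_abelian_cent _ 'F(G)%G) => //.
- exact: solvableS solG.
- by rewrite cycle_subG (subsetP nFG).
- by rewrite cycle_subG.
- exact: subset_trans nFG.
- by rewrite (pnat_coprime rA) // pnatE // !inE eq_sym.
- by rewrite cent_cycle.
apply/trivgP; rewrite -(coprime_TIg coFA) subsetI subsetIl andbT.
by rewrite (subset_trans _ (cent_sub_Fitting solG)) // setSI.
Qed.

Lemma unlinked_regular (gT : finGroupType) (G : {group gT}) (u x : gT) :
  u \in G -> unlinked G u -> x \in <[u]>^# -> semiregular 'F(G) 'C_G[x].
Proof.
move=> Gu unlU /setD1P[ntx ux]; apply: unlU; apply/setD1P; split=> //.
rewrite inE (subsetP _ x ux) ?cycle_subG //=.
by case/cycleP: ux => i ->; rewrite groupX ?cent1id.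
Qed.

Lemma cycle_prime_elt (gT : finGroupType) (u : gT) (p : nat) :
  p \in \pi(#[u]) -> exists2 x, x \in <[u]>^# & #[x] = p.
Proof.
rewrite mem_primes => /and3P[p_pr _ p_dv].
have [x ux ox] := Cauchy p_pr p_dv; exists x => //.
by apply/setD1P; rewrite -order_gt1 ox prime_gt1.
Qed.

Lemma normal_cyclic_center_elt (gT : finGroupType) (H Q : {group gT})
    (r : nat) :
    r.-group Q -> Q :!=: 1 -> Q <| H -> cyclic 'Z(Q) ->
  exists y, [/\ y \in 'Z(Q), #[y] = r & <[y]> <| H].
Proof.
move=> rQ ntQ nsQH cycZ; have [r_pr _ _] := pgroup_pdiv rQ ntQ.
have ntZ : 'Z(Q) != 1 by rewrite center_nil_eq1 ?(pgroup_nil rQ).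
have [_ r_dv _] := pgroup_pdiv (pgroupS (center_sub Q) rQ) ntZ.
have [y Zy oy] := Cauchy r_pr r_dv; exists y; split=> //.
have charY : <[y]> \char 'Z(Q) by rewrite sub_cyclic_char ?cycle_subG.
exact: char_normal_trans (char_trans charY (center_char Q)) nsQH.
Qed.

(** If some [t] in ['O_r(H)^#] has a nontrivial fixed point, no nontrivial power of [u] commutes
    with [t]. But powers of [u] of prime order centralize the abelian subgroups of ['O_r(H)] that
    they normalize, which eventually yields a power commuting with [t] or a path through a central
    element [y]. *)
Lemma unlinked_semiregular_pcore (gT : finGroupType) (G H : {group gT})
    (u : gT) (r : nat) :
    solvable G -> 'F(G) ><| H = G -> u \in H^# -> unlinked G u ->
  semiregular 'F(G) 'O_r(H).
Proof.
move=> solG defG /setD1P[ntu Hu] unlU t /setD1P[ntt Ot].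
have [_ sHG defFH nFH tiFH] := sdprod_context defG.
have [sFG nFG] := andP (Fitting_normal G).
have Gu := subsetP sHG u Hu; have regx x := @unlinked_regular _ G u x Gu unlU.
have sUH : <[u]> \subset H by rewrite cycle_subG.
have Ht : t \in H := subsetP (pcore_sub _ _) t Ot; have Gt := subsetP sHG t Ht.
have ntF : 'F(G) != 1.
  by rewrite trivg_Fitting //; apply: contraNneq ntu => G1; apply/eqP/set1gP;
    rewrite -G1.
have rO : r.-group 'O_r(H) := pcore_pgroup _ _.
have ntO : 'O_r(H) != 1 by apply/trivgPn; exists t.
have [r_pr _ _] := pgroup_pdiv rO ntO.
apply/eqP; apply: contraT => /eqP fix_t.
have noc x : x \in <[u]>^# -> t \notin 'C[x].
  move=> ux; apply/negP=> cxt; apply: fix_t; apply: (regx x ux).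
  by apply/setD1P; rewrite inE Gt.
have cFx1 x : x \in <[u]>^# -> 'C_('F(G))[x] = 1.
  move=> ux; apply: (regx x ux); case/setD1P: ux => ntx ux.
  by apply/setD1P; rewrite inE cent1id (subsetP sHG) ?(subsetP sUH).
(* If [#[x] = r], an element [z] of order [r] in the center of a Sylow subgroup [P] containing [x]
   and [t] commutes with [x]. As ['C_G[x]] is semiregular, [<[x]> = <[z]>], so [x] commutes with
   [t]. *)
have neq_r x : x \in <[u]>^# -> r != #[x].
  move=> ux; have [ntx u_x] := setD1P ux; apply: contraNneq (noc x ux) => def_r.
  have [P sylP sxP] : {P : {group gT} | r.-Sylow(H) P & <[x]> \subset P}.
    by apply: Sylow_superset; rewrite ?cycle_subG ?(subsetP sUH)
      // /pgroup def_r pnat_id // -def_r.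
  have rP := pHall_pgroup sylP; have sPH := pHall_sub sylP.
  have Pt : t \in P by rewrite (subsetP (pcore_sub_Hall sylP)).
  have ntZ : 'Z(P) != 1.
    by rewrite center_nil_eq1 ?(pgroup_nil rP) //; apply/trivgPn; exists t.
  have [_ r_dv _] := pgroup_pdiv (pgroupS (center_sub P) rP) ntZ.
  have [z /setIP[Pz cPz] oz] := Cauchy r_pr r_dv.
  have Px : x \in P by rewrite -cycle_subG.
  have cxz : z \in 'C[x] by rewrite -cent_cycle (subsetP _ z cPz) // centS.
  have eq_xz : <[x]> = <[z]>.
    apply: (@semiregular_cycle_eq _ 'F(G)%G 'C_G[x]%G) (regx x ux)
      _ _ _ _ => //.
    - exact: solvableS solG.
    - by rewrite (subset_trans (subsetIl _ _)).
    - by rewrite inE cent1id (subsetP sHG) ?(subsetP sPH).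
    - by rewrite inE cxz (subsetP sHG) ?(subsetP sPH).
    - by rewrite cent1C.
    by rewrite -def_r.
  have /setIP[_ cPx] : x \in 'Z(P).
    rewrite (subsetP _ x (_ : x \in <[z]>)) ?cycle_subG ?inE ?Pz //.
    by rewrite -eq_xz cycle_id.
  by rewrite cent1C; apply/cent1P; apply: (centP cPx).
have [p0 pi_p0] : exists p, p \in \pi(#[u]).
  by exists (pdiv #[u]); rewrite pi_pdiv order_gt1.
have [x0 ux0 ox0] := cycle_prime_elt pi_p0.
have primx (x : gT) p : #[x] = p -> p \in \pi(#[u]) -> prime #[x].
  by move=> ->; rewrite mem_primes => /andP[].
have Gx x : x \in <[u]>^# -> x \in G.
  by case/setD1P=> _ ux; rewrite (subsetP sHG) ?(subsetP sUH).
have Hx x : x \in <[u]>^# -> x \in H by case/setD1P=> _; apply: subsetP.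
have r'F : r^'.-group 'F(G).
  by apply: (pcore_complement_p'group solG defG (Gx _ ux0)
    (primx _ _ ox0 pi_p0) (regx _ ux0)).
have sOG : 'O_r(H) \subset G := subset_trans (pcore_sub _ _) sHG.
have cxA x (A : {group gT}) :
  prime #[x] -> x \in <[u]>^# -> A \subset 'O_r(H) ->
    x \in 'N(A) -> abelian A -> A \subset 'C[x].
  move=> prx ux sAO nAx abA.
  apply: (@fixfree_cent_abelian _ G A x r) => //.
  - by rewrite inE Gx.
  - exact: cFx1.
  - exact: subset_trans sOG.
  - exact: pgroupS rO.
  exact: neq_r.
have sZO : 'Z('O_r(H)) \subset 'O_r(H) := center_sub _.
have nZx x : x \in H -> x \in 'N('Z('O_r(H))).
  by apply: (subsetP _ x); rewrite !gFnorm_trans.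
have cZ : 'Z('O_r(H)) \subset 'C[x0].
  exact: cxA (primx _ _ ox0 pi_p0) ux0 sZO (nZx _ (Hx _ ux0))
    (center_abelian _).
have cycZ : cyclic 'Z('O_r(H)).
  apply: (@semiregular_abelian_cyclic _ 'F(G)%G) => //.
  - exact: solvableS solG.
  - by rewrite (subset_trans _ nFG) // (subset_trans sZO).
  - exact: center_abelian.
  by apply: semiregularS (regx x0 ux0) => //;
    rewrite subsetI cZ (subset_trans sZO).
have [y [Zy oy nsYH]] := normal_cyclic_center_elt rO ntO (pcore_normal _ _)
  cycZ.
have [Oy cOy] := setIP Zy.
have cyt : t \in 'C[y] by rewrite cent1C; apply/cent1P; apply: (centP cOy).
(* Here [u - y - t] contradicts [unlinked G u] if [u] centralizes [y]; otherwise
   some [p]-part of [u] acts on <[y]> with [p %| r.-1], so the powers of [u] of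
   order [p] centralize 'O_r(H). *)
have [cyu | ncyu] := boolP (u \in 'C[y]).
  case: fix_t; apply: (unlU y); last by apply/setD1P; rewrite inE Gt.
  by apply/setD1P; rewrite -order_gt1 oy prime_gt1 // inE (subsetP sOG)
    //= cent1C.
have [p pi_p ncyv] := constt_notin ncyu.
have [x ux ox] := cycle_prime_elt pi_p.
have p_pr : prime p by rewrite -ox (primx _ _ ox pi_p).
have p_dv : p %| r.-1.
  rewrite -oy; apply: (pelt_nonfix_prime (p_elt_constt _ _) _ _ ncyv);
    first by rewrite oy.
  rewrite (subsetP (normal_norm nsYH)) // (subsetP sUH) //; exact: mem_cycle.
case/negP: (noc x ux); apply: (subsetP _ t Ot).
rewrite -cent_cycle centsC.
apply: (coprime_cent_pgroup_pred r_pr p_pr p_dv ox rO).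
  by rewrite cycle_subG (subsetP _ x (Hx x ux)) ?gFnorm.
move=> A sAO; rewrite cycle_subG => nAx abA; rewrite centsC cent_cycle.
by apply: cxA; rewrite ?ox.
Qed.

Lemma unlinked_structure (gT : finGroupType) (G H : {group gT}) (u : gT) :
    solvable G -> 'F(G) ><| H = G -> u \in H^# -> unlinked G u ->
  exists K : {group gT}, exists y,
    [/\ y \in K^#, K \subset 'C_H[y], semiregular 'F(G) K,
        {in H^#, forall w, semiregular 'F(G) <[w]> -> w \in K}
      & K :=: H \/ {in K, forall x, prime #[x] -> <[x]> <| H}].
Proof.
move=> solG defG Hu1 unlU; have [ntu Hu] := setD1P Hu1.
have [_ sHG defFH nFH tiFH] := sdprod_context defG.
have [sFG nFG] := andP (Fitting_normal G).
have solF := solvableS sFG solG; have solH := solvableS sHG solG.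
have Gu := subsetP sHG u Hu.
have ntF : 'F(G) != 1.
  by rewrite trivg_Fitting //; apply: contraNneq ntu => G1; apply/eqP/set1gP;
    rewrite -G1.
have regO (r : nat) := @unlinked_semiregular_pcore _ G H u r solG defG Hu1 unlU.
have sOH (r : nat) : 'O_r(H) \subset H := pcore_sub _ _.
have p'F (r : nat) : 'O_r(H) != 1 -> r^'.-group 'F(G).
  have pi_u : pdiv #[u] \in \pi(#[u]) by rewrite pi_pdiv order_gt1.
  have [x ux ox] := cycle_prime_elt pi_u.
  move=> ntO; apply: (@pcore_complement_p'group _ G H x r) => //.
  - by case/setD1P: ux => _; apply: subsetP; rewrite cycle_subG.
  - by rewrite ox pdiv_prime ?order_gt1.
  exact: unlinked_regular ux.
have oO (r : nat) : ('O_r(H) != 1) = (r \in \pi('F(H))).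
  apply/idP/idP=> [ntO | pi_r].
    have [r_pr r_dv _] := pgroup_pdiv (pcore_pgroup r H) ntO.
    rewrite mem_primes r_pr cardG_gt0 (dvdn_trans r_dv) // cardSg //.
    by rewrite /= -p_core_Fitting pcore_sub.
  rewrite -p_core_Fitting -cardG_gt1.
  by rewrite (card_Hall (nilpotent_pcore_Hall r (Fitting_nil H))) p_part_gt1.
have ntH : 'F(H) != 1.
  by rewrite trivg_Fitting //; apply: contraNneq ntu => H1; apply/eqP/set1gP;
    rewrite -H1.
(* Minimality of [q] is used twice: if [q] is odd, all ['O_r(H)] have odd order and are cyclic; and
   no prime [p] dividing [q.-1] has ['O_p(H) != 1]. *)
pose q := pdiv #|'F(H)|.
have q_pr : prime q by rewrite pdiv_prime ?cardG_gt1.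
have q_min (p : nat) : 'O_p(H) != 1 -> q <= p.
  rewrite oO mem_primes => /and3P[p_pr _ p_dv].
  by rewrite pdiv_min_dvd // prime_gt1.
have cycO (r : nat) : q != 2 -> cyclic 'O_r(H).
  move=> q_neq2; have [-> | ntO] := eqVneq 'O_r(H) 1; first exact: cyclic1.
  have [r_pr _ _] := pgroup_pdiv (pcore_pgroup r H) ntO.
  apply: (@semiregular_pgroup_cyclic _ 'F(G)%G _ r) => //.
  - by rewrite (subset_trans (sOH r)).
  - exact: regO.
  - exact: pcore_pgroup.
  apply: odd_pgroup_odd (pcore_pgroup r H).
  have := q_min r ntO; case: (even_prime r_pr) => // ->.
  by rewrite leqNgt ltn_neqAle eq_sym q_neq2 prime_gt1.
(* Otherwise [x] centralizes every ['O_r(H)], hence ['F(H)], and so lies in ['F(H)], whose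
   [#[x]]-part is trivial. *)
have piO x : q != 2 -> x \in H -> prime #[x] -> 'C_('F(G))[x] = 1 ->
  'O_(#[x])(H) != 1.
  move=> q_neq2 Hx prx cFx1; apply/negP=> /eqP Ox1;
    have ntx : x != 1 by rewrite -order_gt1 prime_gt1.
  have cFHx : x \in 'C('F(H)).
    rewrite -sub_cent1 FittingEgen gen_subG; apply/bigcupsP=> r _.
    have [-> | ntO] := eqVneq 'O_r(H) 1; first by rewrite sub1G.
    apply: (@fixfree_cent_abelian _ G _ x r) => //.
    - by rewrite inE (subsetP sHG) // (subsetP (gFnorm _ _)).
    - by rewrite (subset_trans (sOH r)).
    - exact: pcore_pgroup.
    - by apply: contraNneq ntO => ->; rewrite Ox1.
    - exact: p'F.
    exact: cyclic_abelian (cycO r q_neq2).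
  have Fx : x \in 'F(H) by rewrite (subsetP (cent_sub_Fitting solH)) // inE Hx.
  case/negP: ntx; rewrite -in_set1 -[[set 1]]Ox1 -p_core_Fitting.
  rewrite (mem_normal_Hall (nilpotent_pcore_Hall _ (Fitting_nil H)))
    ?pcore_normal //.
  by rewrite /p_elt pnat_id.
have ntOq : 'O_q(H) != 1 by rewrite oO pi_pdiv cardG_gt1.
have cycZ : cyclic 'Z('O_q(H)).
  apply: (semiregular_abelian_cyclic solF) => //.
  - by rewrite (subset_trans (center_sub _)) // (subset_trans (sOH q)).
  - exact: center_abelian.
  exact: semiregularS (center_sub _) (regO q).
have [y [Zy oy nsYH]] := normal_cyclic_center_elt (pcore_pgroup q H)
  ntOq (pcore_normal _ _) cycZ.
have Oy := subsetP (center_sub _) y Zy; have Hy := subsetP (sOH q) y Oy.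
have nyH : H \subset 'N(<[y]>) := normal_norm nsYH.
(* If [w] does not centralize [y], a prime [p] dividing [#[w]] divides [q.-1], so [p < q]; but
   [piO], applied to a power of [w] of order [p], gives [q <= p]. *)
have fpfK w : w \in H^# -> semiregular 'F(G) <[w]> -> w \in 'C_H[y].
  case/setD1P=> ntw Hw regw; rewrite inE Hw /=; apply: contraT => ncyw.
  have [p pi_p ncyv] := constt_notin ncyw.
  have [x wx ox] := cycle_prime_elt pi_p.
  have p_pr : prime p by move: pi_p; rewrite mem_primes => /andP[].
  have p_dv : p %| q.-1.
    rewrite -oy; apply: (pelt_nonfix_prime (p_elt_constt _ _) _ _ ncyv);
      first by rewrite oy.
    by rewrite (subsetP nyH) // (subsetP _ _ (mem_cycle _ _)) ?cycle_subG.
  have lt_pq : p < q by rewrite -(prednK (prime_gt0 q_pr))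
    ltnS dvdn_leq // -ltnS prednK ?prime_gt1 ?prime_gt0.
  have q_neq2 : q != 2 by apply: contraTneq lt_pq => ->;
    rewrite -leqNgt prime_gt1.
  have [_ wx'] := setD1P wx.
  have := piO x q_neq2; rewrite ox (subsetP _ _ wx') ?cycle_subG // =>
    /(_ isT p_pr (regw x wx))/q_min.
  by rewrite leqNgt lt_pq.
have regu : semiregular 'F(G) <[u]>.
  have u1 : u \in <[u]>^# by apply/setD1P; rewrite cycle_id.
  by apply: semiregularS (unlinked_regular Gu unlU u1);
    rewrite ?cycle_subG // inE Gu cent1id.
have ntY : y != 1 by rewrite -order_gt1 oy prime_gt1.
have Ku := fpfK u Hu1 regu.
have regK : semiregular 'F(G) 'C_H[y].
  apply: (@semiregularS _ _ 'F(G) _ 'C_G[y]) => //; first by rewrite setSI.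
  apply: unlU; apply/setD1P; split=> //; rewrite inE (subsetP sHG) //= cent1C.
  by case/setIP: Ku.
exists 'C_H[y]%G, y; split=> //.
  by apply/setD1P; rewrite inE Hy cent1id.
(* A group of order 2 has no nontrivial automorphism, so [H] centralizes [y] when [q = 2]. *)
have [q2 | q_neq2] := eqVneq q 2.
  left; apply/setIidPl/subsetP=> h Hh; apply: contraT => ncyh.
  have [p pi_p ncyv] := constt_notin ncyh.
  have p_pr : prime p by move: pi_p; rewrite mem_primes => /andP[].
  have : p %| #[y].-1.
    apply: (pelt_nonfix_prime (p_elt_constt _ _) _ _ ncyv); first by rewrite oy.
    by rewrite (subsetP nyH) // (subsetP _ _ (mem_cycle _ _)) ?cycle_subG.
  by rewrite oy q2 dvdn1 => /eqP p1; rewrite p1 in p_pr.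
right=> x Kx prx; have [Hx _] := setIP Kx.
have ntx : x != 1 by rewrite -order_gt1 prime_gt1.
have ntO : 'O_(#[x])(H) != 1 by apply: piO => //; apply: regK; apply/setD1P.
(* [<[x0]>] is normal in [H] and of the same prime order as [x]; it equals [<[x]>] once [x] commutes
   with [x0], which holds because that prime [p] does not divide [p.-1]. *)
have [x0 [Zx0 ox0 nsX0]] := normal_cyclic_center_elt (pcore_pgroup _ H) ntO
  (pcore_normal _ _) (cyclicS (center_sub _) (cycO _ q_neq2)).
have Ox0 := subsetP (center_sub _) x0 Zx0; have Hx0 := subsetP (sOH _) x0 Ox0.
have Kx0 : x0 \in 'C_H[y].
  apply: fpfK; first by apply/setD1P; rewrite -order_gt1 ox0 prime_gt1.
  by apply: semiregularS (regO #[x]); rewrite ?cycle_subG.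
rewrite (@semiregular_cycle_eq _ 'F(G)%G 'C_H[y]%G x x0) //.
  by rewrite (subset_trans (subsetIl _ _)).
apply: contraT => ncx; have : #[x] %| #[x0].-1.
  apply: pelt_nonfix_prime ncx; rewrite ?ox0 //.
    by rewrite /p_elt pnat_id.
  by rewrite (subsetP (normal_norm nsX0)).
by rewrite ox0; case: #[x] (prime_gt1 prx) => [|[|n]] // _; rewrite gtnNdvd.
Qed.

(** * Elements without fixed points on the Fitting subgroup, and their links to it *)

Definition fixfree (gT : finGroupType) (G : {group gT}) (w : gT) : bool :=
  [forall x in <[w]>^#, 'C_('F(G))[x] == 1].

Definition normalizes (gT : finGroupType) (x y : gT) : bool := y \in 'N(<[x]>).

Lemma fixfreeP (gT : finGroupType) (G : {group gT}) (w : gT) :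
  reflect (semiregular 'F(G) <[w]>) (fixfree G w).
Proof. by apply: (iffP forall_inP) => reg x wx; apply/eqP/reg. Qed.

Lemma not_fixfreeP (gT : finGroupType) (G : {group gT}) (w : gT) :
  ~~ fixfree G w -> exists s f, [/\ s \in <[w]>^#, f \in 'F(G)^# & f \in 'C[s]].
Proof.
case/forall_inPn=> s ws /trivgPn[f /setIP[Ff csf] ntf].
by exists s, f; split=> //; apply/setD1P.
Qed.

Lemma commute_normalizes (gT : finGroupType) (x y : gT) :
  y \in 'C[x] -> normalizes x y.
Proof. by move=> cxy; rewrite /normalizes (subsetP (cent_sub _))
  ?cent_cycle. Qed.

Lemma cycle_cent1 (gT : finGroupType) (x y : gT) : x \in <[y]> -> x \in 'C[y].
Proof. by case/cycleP=> i ->; rewrite groupX ?cent1id. Qed.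

Lemma normalizesJ (gT : finGroupType) (x y g : gT) :
  normalizes (x ^ g) (y ^ g) = normalizes x y.
Proof. by rewrite /normalizes cycleJ normJ memJ_conjg. Qed.

Lemma normalizes_mem (gT : finGroupType) (x y s : gT) :
  normalizes x y -> s \in <[x]> -> normalizes s y.
Proof.
move=> nxy xs; apply: subsetP nxy; apply: char_norms.
by rewrite sub_cyclic_char ?cycle_cyclic // cycle_subG.
Qed.

(** Inside ['F(G) * <[w]>], both [<[w]>] and the trace [L] of [H] are complements of ['F(G)], of
    coprime order, hence conjugate by Schur-Zassenhaus. *)
Lemma fixfree_conj_complement (gT : finGroupType) (G H : {group gT}) (w : gT) :
    solvable G -> 'F(G) ><| H = G -> w \in G -> fixfree G w ->
  exists2 f, f \in 'F(G) & w ^ f \in H.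
Proof.
move=> solG defG Gw /fixfreeP regw; have [sFG nFG] := andP (Fitting_normal G).
have [_ sHG defFH nFH tiFH] := sdprod_context defG.
have nFw : <[w]> \subset 'N('F(G)) by rewrite cycle_subG (subsetP nFG).
have coFw := regular_norm_coprime nFw regw.
pose L := (H :&: ('F(G) <*> <[w]>))%G.
have defL : 'F(G) * L = 'F(G) * <[w]>.
  rewrite /L /= group_modl ?joing_subl // defFH /= norm_joinEr //.
  by apply/setIidPr; rewrite mul_subG // cycle_subG.
have oL : #|L| = #|<[w]>|.
  apply/eqP; rewrite -(eqn_pmul2l (cardG_gt0 'F(G))) -(coprime_cardMg coFw)
    -defL.
  by rewrite TI_cardMg //; apply/trivgP; rewrite -tiFH setIS ?subsetIl.
have [|f Ff defLw] := SchurZassenhaus_trans_sol (solvableS sFG solG)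
  nFw _ coFw oL.
  by rewrite -defL mulG_subr.
exists f => //; have : w ^ f \in L by rewrite defLw memJ_conjg cycle_id.
by case/setIP.
Qed.

(** The commutator of [k] and [f] lies in both ['F(G)] and [H], so [f] centralizes [k]. This makes
    distinct conjugates of [K^#] under ['F(G)] disjoint. *)
Lemma complement_conj_eq1 (gT : finGroupType) (G H : {group gT}) (k f : gT) :
    'F(G) ><| H = G -> k \in H -> 'C_('F(G))[k] = 1 -> f \in 'F(G) ->
      k ^ f \in H ->
  f = 1.
Proof.
move=> defG Hk cFk1 Ff Hkf; have [_ sHG _ nFH tiFH] := sdprod_context defG.
have nFk := subsetP nFH k Hk; apply/set1gP; rewrite -cFk1 inE Ff /= cent1C.
apply/cent1P/commgP/eqP/set1gP; rewrite -tiFH; apply/setIP; split.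
  by rewrite commgEr groupMr // memJ_norm ?groupV.
by rewrite commgEl groupMr ?groupV.
Qed.

(** Writing [g = h * f], the element [k ^ h] and its conjugate by [f] both lie in [H], which forces
    [f = 1]. *)
Lemma fixfree_normalizer_sub (gT : finGroupType) (G H : {group gT}) (k g : gT) :
    'F(G) ><| H = G -> k \in H -> 'C_('F(G))[k] = 1 -> g \in G ->
    normalizes k g -> g \in H.
Proof.
move=> defG Hk cFk1 Gg nkg; have [_ sHG defFH nFH _] := sdprod_context defG.
move: Gg; rewrite -defFH -(normC nFH) => /mulsgP[h f Hh Ff def_g].
suff f1 : f = 1 by rewrite def_g f1 mulg1.
have nFh := subsetP nFH h Hh.
apply: (complement_conj_eq1 (k := k ^ h) defG) => //; first exact: groupJ.
  by rewrite -(normP nFh) -conjg_set1 normJ -conjIg cFk1 conjs1g.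
rewrite -conjgM -def_g; apply: (subsetP (_ : <[k]> \subset H));
  first by rewrite cycle_subG.
by rewrite memJ_norm ?cycle_id.
Qed.

(** Consecutive elements may coincide, so the paths have length at most 3; the two ends in ['F(G)]
    may differ. *)
Definition linked_Fitting (gT : finGroupType) (G : {group gT}) (u : gT) :
  Prop :=
  (exists a b f, [/\ a \in G^#, b \in G^#, f \in 'F(G)^#
     & [&& normalizes u a, normalizes a b & normalizes b f]]) /\
  (exists a b f, [/\ a \in G^#, b \in G^#, f \in 'F(G)^#
     & [&& normalizes f b, normalizes b a & normalizes a u]]).

Lemma linked_FittingJ (gT : finGroupType) (G : {group gT}) (u g : gT) :
  g \in G -> linked_Fitting G u -> linked_Fitting G (u ^ g).
Proof.
move=> Gg; have nFg : g \in 'N('F(G))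
  by rewrite (subsetP (normal_norm (Fitting_normal G))).
have GJ a : a \in G^# -> a ^ g \in G^# by rewrite !inE conjg_eq1 groupJr.
have FJ a : a \in 'F(G)^# -> a ^ g \in 'F(G)^#
  by rewrite !inE conjg_eq1 memJ_norm.
by case=> [[a [b [f [Ga Gb Ff nabf]]]] [a' [b' [f' [Ga' Gb' Ff' nabf']]]]];
  split;
  [exists (a ^ g), (b ^ g), (f ^ g) | exists (a' ^ g), (b' ^ g), (f' ^ g)];
  rewrite !normalizesJ; split=> //; auto.
Qed.

Lemma linked_Fitting_cent (gT : finGroupType) (G : {group gT}) (u y t f : gT) :
    y \in 'C_G[u]^# -> t \in 'C_G[y]^# -> f \in 'C_('F(G))[t]^# ->
  linked_Fitting G u.
Proof.
case/setD1P=> nty /setIP[Gy cuy] /setD1P[ntt /setIP[Gt cyt]] /setD1P[ntf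
  /setIP[Ff ctf]].
have [Gy1 Gt1 Ff1] : [/\ y \in G^#, t \in G^# & f \in 'F(G)^#] by split;
  apply/setD1P.
by split; exists y, t, f; split=> //; rewrite !commute_normalizes // cent1C.
Qed.

(** The first alternative holds if no fixfree element is unlinked, and also if [K] is proper in [H]
    and an arc enters [K^#] from outside. In the remaining cases [K^#] is closed under outgoing arcs
    ([K = H]) or under incoming arcs. *)
Lemma fixfree_dichotomy (gT : finGroupType) (G : {group gT}) :
    solvable G ->
  {in G^#, forall u, fixfree G u -> linked_Fitting G u} \/
  exists H K : {group gT}, exists y,
    [/\ 'F(G) ><| H = G, y \in K^#, K \subset 'C_H[y], semiregular 'F(G) K
      & {in G^#, forall w, fixfree G w ->
        exists2 f, f \in 'F(G) & w ^ f \in K} /\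
        ({in K^# & G^#, forall k w, normalizes k w -> w \in K} \/
         {in K^# & G^#, forall k w, normalizes w k -> w \in K})].
Proof.
move=> solG; have [sFG nFG] := andP (Fitting_normal G).
pose unlinkedb u := [forall y in 'C_G[u]^#, [forall t in 'C_G[y]^#,
  'C_('F(G))[t] == 1]].
have [/exists_inP[u /setD1P[ntu Gu] /andP[ffu unlu]] | ] :=
    boolP [exists u in G^#, fixfree G u && unlinkedb u]; last first.
  move/exists_inPn=> no_unl; left=> u Gu ffu.
  have := no_unl u Gu; rewrite ffu => /forall_inPn[y cuy /forall_inPn[t cyt]].
  case/trivgPn=> f cFf ntf; apply: (linked_Fitting_cent cuy cyt (f := f)).
  exact/setD1P.
have {}unlu : unlinked G u.
  by move=> y cuy t cyt; have /forall_inP/(_ y cuy)/forall_inP/(_ t cyt)/eqP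
    := unlu.
have [H defG Hu] : exists2 H : {group gT}, 'F(G) ><| H = G & u \in H.
  have pi_u : pdiv #[u] \in \pi(#[u]) by rewrite pi_pdiv order_gt1.
  have [x ux ox] := cycle_prime_elt pi_u.
  have [|||H defG] := @Fitting_complement_exists _ G x solG.
  - by case/setD1P: ux => _; apply: subsetP; rewrite cycle_subG.
  - by rewrite ox pdiv_prime ?order_gt1.
  - exact: unlinked_regular ux.
  have [f Ff Huf] := fixfree_conj_complement solG defG Gu ffu.
  exists (H :^ f^-1)%G; last by rewrite /= mem_conjg invgK.
  have Gf : f^-1 \in G by rewrite groupV (subsetP sFG).
  have nFf : 'F(G) :^ f^-1 = 'F(G) by apply/normP; rewrite (subsetP nFG).
  by rewrite /= -{1}nFf -sdprodJ defG conjGid.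
have [_ sHG defFH nFH tiFH] := sdprod_context defG.
have Hu1 : u \in H^# by apply/setD1P.
have [K [y [Ky sKC regK ffK HK]]] := unlinked_structure solG defG Hu1 unlu.
have sKH : K \subset H := subset_trans sKC (subsetIl _ _).
have sKG := subset_trans sKH sHG.
have conjK : {in G^#, forall w, fixfree G w ->
  exists2 f, f \in 'F(G) & w ^ f \in K}.
  move=> w /setD1P[ntw Gw] ffw.
  have [f Ff Hwf] := fixfree_conj_complement solG defG Gw ffw; exists f => //.
  apply: ffK; first by apply/setD1P; rewrite conjg_eq1.
  have Gf := subsetP sFG f Ff.
  rewrite cycleJ -(normP (subsetP nFG f Gf)); apply: semiregularJ;
    exact/fixfreeP.
have normK k g : k \in K^# -> g \in G -> normalizes k g -> g \in H.
  move=> Kk; have cFk1 := regK k Kk; have [_ Kk'] := setD1P Kk.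
  exact: fixfree_normalizer_sub defG (subsetP sKH k Kk') cFk1.
have [defK | neqKH] := eqVneq (K : {set gT}) H.
  right; exists H, K, y; split=> //; split=> //; left=> k w Kk /setD1P[_ Gw].
  by rewrite defK; apply: normK.
case: HK => [defK | nsXH]; first by rewrite defK eqxx in neqKH.
have [/exists_inP[k Kk /exists_inP[w /setDP[Gw1 notKw] nwk]] | ] :=
    boolP [exists k in K^#, exists w in G^# :\: K, normalizes w k]; last first.
  move/exists_inPn=> no_in; right; exists H, K, y; split=> //; split=> //.
  right=> k w Kk Gw nwk; apply: contraT => notKw.
  have wD : w \in G^# :\: K by apply/setDP.
  by have /exists_inPn/(_ w wD)/negP := no_in k Kk.
left=> u1 /setD1P[ntu1 Gu1] ffu1; have [_ Kk'] := setD1P Kk.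
have [f Ff Ku1f] := conjK u1 (introT setD1P (conj ntu1 Gu1)) ffu1.
have Gf := subsetP sFG f Ff.
(* Links are invariant under conjugation, so [u1] may be assumed to lie in [K]. *)
rewrite -(conjgK f u1); apply: linked_FittingJ; first by rewrite groupV.
have ntu1f : u1 ^ f != 1 by rewrite conjg_eq1.
move: (u1 ^ f) Ku1f ntu1f => {u1 ntu1 Gu1 ffu1} u1 Ku1 ntu1.
have primeK v : v \in K^# -> exists2 x, x \in <[v]>^# & <[x]> <| H.
  case/setD1P=> ntv Kv; have pi_v : pdiv #[v] \in \pi(#[v])
    by rewrite pi_pdiv order_gt1.
  have [x vx ox] := cycle_prime_elt pi_v; exists x => //; apply: nsXH.
    by case/setD1P: vx => _; apply: subsetP; rewrite cycle_subG.
  by rewrite ox pdiv_prime ?order_gt1.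
have Ku11 : u1 \in K^# by apply/setD1P.
have cycG (v x : gT) : v \in G -> x \in <[v]>^# -> x \in G^#.
  move=> Gv /setD1P[ntx vx]; apply/setD1P; split=> //.
  by rewrite (subsetP _ x vx) ?cycle_subG.
(* The path to ['F(G)] is [u1], [x], [t], [f1]: [x] is a power of [u1] generating a normal subgroup
   of [H], and [t] is a power of some [h] in [H] outside [K]. *)
split.
  have [h Hh notKh] : exists2 h, h \in H & h \notin K.
    by apply/subsetPn; apply: contra neqKH => sHK; rewrite eqEsubset sKH.
  have nth : h != 1 by apply: contraNneq (notKh) => ->; apply: group1.
  have nffh : ~~ fixfree G h.
    by apply: contra notKh => /fixfreeP ffh; apply: ffK => //; apply/setD1P.
  have [t [f1 [ht Ff1 ctf]]] := not_fixfreeP nffh.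
  have [x u1x nsX] := primeK u1 Ku11.
  exists x, t, f1; split=> //.
  - exact: cycG (subsetP sKG u1 Ku1) u1x.
  - exact: cycG (subsetP sHG h Hh) ht.
  have [_ u1x'] := setD1P u1x; have [_ ht'] := setD1P ht.
  apply/and3P; split; try by rewrite commute_normalizes // cycle_cent1.
  by rewrite /normalizes (subsetP (normal_norm nsX)) // (subsetP _ t ht')
    ?cycle_subG.
(* The path from ['F(G)] is [f1], [s], [x], [u1], with [s] a power of [w] and [x] a power of [k];
   the last arc exists because [<[x]>] is normal in [H]. *)
have [/setD1P[ntw Gw] [ntk _]] := (Gw1, setD1P Kk);
  have Hk := subsetP sKH k Kk'.
have nffw : ~~ fixfree G w.
  apply/negP=> ffw; have [f1 Ff1 Kwf] := conjK w Gw1 ffw.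
  have Gf1 := subsetP sFG f1 Ff1; have Gk := subsetP sHG k Hk.
  have Hkf : k ^ f1 \in H.
    apply: (normK (w ^ f1)); first by apply/setD1P; rewrite conjg_eq1.
      by rewrite groupJ.
    by rewrite normalizesJ.
  have f11 := complement_conj_eq1 defG Hk (regK k Kk) Ff1 Hkf.
  by move: Kwf; rewrite f11 conjg1; apply/negP.
have [s [f1 [ws Ff1 csf]]] := not_fixfreeP nffw.
have [x kx nsX] := primeK k Kk; have [_ kx'] := setD1P kx;
  have [_ ws'] := setD1P ws.
exists x, s, f1; split=> //.
- exact: cycG (subsetP sHG k Hk) kx.
- exact: cycG Gw ws.
rewrite commute_normalizes 1?cent1C //=; apply/andP; split.
  apply: (subsetP _ x kx'); rewrite cycle_subG; exact: normalizes_mem nwk ws'.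
by rewrite /normalizes (subsetP (normal_norm nsX)) // (subsetP sKH).
Qed.

(** * Universal vertices *)

Lemma normalizingE (gT : finGroupType) (x y : gT) :
  normalizing x y = normalizes x y.
Proof.
rewrite /normalizing /normal cycle_subG mem_gen ?set21 // gen_subG subUset
  !sub1set.
by rewrite (subsetP (normG _)) ?cycle_id.
Qed.

(** A power [z] of prime order of a universal element is central: [[~ z, g]] lies in [<[z]>] and in
    [<[g]>], so if it is nontrivial then [<[z]>] is contained in [<[g]>], and [z] commutes with [g]
    after all. *)
Lemma Univ_center_trivial (gT : finGroupType) (G : {group gT}) :
  'Z(G) = 1 -> Univ G = 1.
Proof.
move=> Z1; apply/setP=> x; rewrite in_set1 inE;
  apply/andP/eqP=> [[Gx /forall_inP Ux] | ->]; last first.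
  split=> //; apply/forall_inP=> y _; rewrite !normalizingE.
  by rewrite /normalizes cycle1 norm1 inE group1.
apply: contraTeq isT => ntx.
have pi_x : pdiv #[x] \in \pi(#[x]) by rewrite pi_pdiv order_gt1.
have [z /setD1P[ntz xz] oz] := cycle_prime_elt pi_x.
have prz : prime #[z] by rewrite oz pdiv_prime ?order_gt1.
have Gz : z \in G by rewrite (subsetP _ z xz) ?cycle_subG.
suff Zz : z \in 'Z(G) by rewrite Z1 in_set1 (negPf ntz) in Zz.
rewrite inE Gz; apply/centP=> g Gg; apply/commgP; rewrite -in_set1.
have [nxg ngx] : normalizes x g /\ normalizes g x.
  by apply/andP; rewrite -!normalizingE Ux.
have nzg := normalizes_mem nxg xz.
have ngz : normalizes g z by apply: (subsetP _ z xz); rewrite cycle_subG.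
have zR : [~ z, g] \in <[z]>
  by rewrite commgEl groupMl ?groupV ?cycle_id // memJ_norm ?cycle_id.
have gR : [~ z, g] \in <[g]>
  by rewrite commgEr groupMr ?cycle_id // memJ_norm ?groupV ?cycle_id.
rewrite in_set1; apply: contraT => ntR; case/negP: (ntR); apply/commgP.
have gz : <[z]> \subset <[g]>.
  apply: contraR ntR => ngz'; have := prime_TIg prz ngz'.
  by move/setP/(_ [~ z, g]); rewrite inE zR gR in_set1 => /esym.
by apply/cent1P/cycle_cent1; rewrite -cycle_subG.
Qed.

(** * Walks of bounded length, diameter and strong components *)

Definition walk (T : finType) (e : rel T) (n : nat) (u v : T) : Prop :=
  exists p, [/\ size p <= n, path e u p & last u p = v].

Lemma walk_refl (T : finType) (e : rel T) n u : walk e n u u.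
Proof. by exists [::]. Qed.

Lemma walk_step (T : finType) (e : rel T) n u v w :
  (u == v) || e u v -> walk e n v w -> walk e n.+1 u w.
Proof.
case/orP=> [/eqP-> | euv] [p [le_pn vp lp]]; first by exists p;
  rewrite (leqW le_pn).
by exists (v :: p); rewrite /= euv.
Qed.

Lemma walk_trans (T : finType) (e : rel T) m n u v w :
  walk e m u v -> walk e n v w -> walk e (m + n) u w.
Proof.
move=> [p [le_pm up <-]] [q [le_qn vq <-]]; exists (p ++ q).
by rewrite size_cat leq_add // cat_path up last_cat.
Qed.

Lemma walk_connect (T : finType) (e : rel T) n u v :
  walk e n u v -> connect e u v.
Proof. by case=> p [_ up <-]; apply/connectP; exists p. Qed.

Lemma distance_le (T : finType) (D : digraph T) n u v :
  walk (darc D) n u v -> distance D u v <= n.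
Proof.
case=> p [le_pn up lp]; apply: leq_trans le_pn; rewrite leqNgt;
  apply/negP=> lt_p.
(* Positions in [iota 0 #|T|] are lengths, and [lt_p] already bounds [size p] by [#|T|], since
   [find] never exceeds the length of its list. *)
have := before_find 0 lt_p; rewrite nth_iota ?add0n; last first.
  by apply: leq_trans lt_p _; rewrite -[X in _ <= X](size_iota 0) find_size.
by case/existsP; exists (in_tuple p); rewrite up lp eqxx.
Qed.

Lemma diameter_le (T : finType) (D : digraph T) n :
  {in vertices D &, forall u v, walk (darc D) n u v} -> diameter D <= n.
Proof.
move=> walkD; apply/bigmax_leqP=> u Du; apply/bigmax_leqP=> v /andP[Dv _].
exact/distance_le/walkD.
Qed.

(** A strongly connected set meeting a member of [P] is contained in it, so members are maximal, and
    by covering every maximal set is a member. *)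
Lemma strong_componentsP (T : finType) (D : digraph T) (P : {set {set T}}) :
    {in P, forall A, [/\ A != set0, A \subset vertices D
                       & strongly_connected (induced D A)]} ->
    {in vertices D, forall v, exists2 A, A \in P & v \in A} ->
    (forall A a b, A \in P -> a \in A -> b \in vertices D ->
       connect (darc D) a b -> connect (darc D) b a -> b \in A) ->
  strong_components D = P.
Proof.
move=> scP covP sepP.
have inA (A B : {set T}) : A \in P -> B \subset vertices D ->
    strongly_connected (induced D B) -> (exists2 a, a \in A & a \in B) ->
      B \subset A.
  move=> PA sBD scB [a Aa Ba]; apply/subsetP=> b Bb.
  have Db := subsetP sBD b Bb; have Da := subsetP sBD a Ba.
  have conB x y : x \in B -> y \in B -> connect (darc D) x y.
    move=> Bx By; have DB z : z \in B -> z \in vertices (induced D B).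
      by move=> Bz; rewrite inE (subsetP sBD).
    have /forall_inP/(_ _ (DB x Bx))/forall_inP/(_ _ (DB y By)) := scB.
    by apply: connect_sub => x' y' /and3P[_ _ /connect1].
  exact: sepP PA Aa Db (conB a b Ba Bb) (conB b a Bb Ba).
apply/setP=> C; rewrite inE;
  apply/idP/idP=> [/maxsetP[/and3P[ntC sCD scC] maxC] | PC].
  have [c Cc] := set0Pn _ ntC; have [A PA Ac] := covP c (subsetP sCD c Cc).
  have sCA : C \subset A by apply: inA => //; exists c.
  by rewrite -(maxC A) //; apply/and3P/scP.
have [ntC sCD scC] := scP C PC; apply/maxsetP; split; first exact/and3P.
move=> B /and3P[ntB sBD scB] sCB; apply/eqP; rewrite eqEsubset sCB andbT.
apply: inA => //; have [c Cc] := set0Pn _ ntC; exists c => //;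
  exact: subsetP sCB c Cc.
Qed.

Lemma connect_out_closed (T : finType) (e : rel T) (C : {pred T}) u v :
    (forall x y, e x y -> x \in C -> y \in C) -> connect e u v -> u \in C ->
  v \in C.
Proof.
move=> closedC /connectP[p up ->];
  elim: p u up => //= x p IHp u /andP[eux xp] Cu.
exact/IHp/(closedC u).
Qed.

Lemma connect_in_closed (T : finType) (e : rel T) (C : {pred T}) u v :
    (forall x y, e x y -> y \in C -> x \in C) -> connect e u v -> v \in C ->
  u \in C.
Proof.
move=> closedC /connectP[p up ->];
  elim: p u up => //= x p IHp u /andP[eux xp] Cv.
exact/(closedC u x)/IHp.
Qed.

(** * Walks among the elements that are not fixfree *)

Lemma not_fixfree_root (gT : finGroupType) (G : {group gT}) (s f : gT) :
    s \in G^# -> f \in 'F(G)^# -> f \in 'C[s] ->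
  s \in [set w in G^# | ~~ fixfree G w].
Proof.
move=> /[dup] /setD1P[nts _] Gs /setD1P[ntf Ff] csf; rewrite inE Gs /=.
apply/forall_inPn; exists s; first by apply/setD1P; rewrite cycle_id.
by apply/trivgPn; exists f; rewrite // inE Ff.
Qed.

Section NonFixfreeWalks.

Variables (gT : finGroupType) (G : {group gT}) (A : {set gT}) (e : rel gT).
Hypothesis stepA : {in A &, forall x y, normalizes x y -> (x == y) || e x y}.
Hypothesis sNA : [set w in G^# | ~~ fixfree G w] \subset A.

Lemma Fitting_not_fixfree f :
  f \in 'F(G)^# -> f \in [set w in G^# | ~~ fixfree G w].
Proof.
move=> Ff; apply: (not_fixfree_root _ Ff); last exact: cent1id.
by apply: subsetP f Ff; rewrite setSD ?Fitting_sub.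
Qed.

(** The walk goes through a central element of ['F(G)]. Leaving [A] and [e] general serves both the
    whole digraph and the subgraph induced on the non-fixfree elements. *)
Lemma Fitting_walk f1 f2 : f1 \in 'F(G)^# -> f2 \in 'F(G)^# -> walk e 2 f1 f2.
Proof.
move=> Ff1 Ff2; have [ntf1 Ff1'] := setD1P Ff1; have [_ Ff2'] := setD1P Ff2.
have ntF : 'F(G) != 1 by apply/trivgPn; exists f1.
have /trivgPn[z /setIP[Fz cFz] ntz] : 'Z('F(G)) != 1.
  by rewrite center_nil_eq1 ?Fitting_nil.
have Az f : f \in 'F(G)^# -> f \in A by move/Fitting_not_fixfree;
  apply: subsetP.
have Fz1 : z \in 'F(G)^# by apply/setD1P.
have czf f : f \in 'F(G) -> f \in 'C[z] by move=> Ff; apply/cent1P;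
  apply/commute_sym/(centP cFz).
apply: (@walk_step _ _ 1 _ z).
  by apply: stepA; rewrite ?Az // commute_normalizes // cent1C czf.
apply: (@walk_step _ _ 0 _ f2); last exact: walk_refl.
by apply: stepA; rewrite ?Az // commute_normalizes // czf.
Qed.

Lemma not_fixfree_walk w : w \in [set w in G^# | ~~ fixfree G w] ->
  exists2 f, f \in 'F(G)^# & walk e 2 w f /\ walk e 2 f w.
Proof.
move=> Nw; have := Nw; rewrite inE =>
  /andP[/setD1P[ntw Gw] /not_fixfreeP[s [f [ws Ff csf]]]].
have [nts ws'] := setD1P ws.
have Gs : s \in G^# by apply/setD1P; rewrite (subsetP _ s ws') ?cycle_subG.
have Aw := subsetP sNA w Nw.
have As := subsetP sNA s (not_fixfree_root Gs Ff csf).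
have Af := subsetP sNA f (Fitting_not_fixfree Ff).
have cws := cycle_cent1 ws'; exists f => //; split.
  apply: (@walk_step _ _ 1 _ s); first by apply: stepA;
    rewrite // commute_normalizes.
  apply: (@walk_step _ _ 0 _ f); last exact: walk_refl.
  by apply: stepA; rewrite // commute_normalizes.
apply: (@walk_step _ _ 1 _ s); first by apply: stepA;
  rewrite // commute_normalizes // cent1C.
apply: (@walk_step _ _ 0 _ w); last exact: walk_refl.
by apply: stepA; rewrite // commute_normalizes // cent1C.
Qed.

End NonFixfreeWalks.

(** * Diameters and components of the reduced digraph *)

Lemma vertices_reducedE (gT : finGroupType) (G : {group gT}) :
  Univ G = 1 -> vertices (reduced_norm_digraph G) = G^#.
Proof. by move=> U1; rewrite /= U1; apply/setIidPr/subD1set. Qed.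

Lemma darc_reducedE (gT : finGroupType) (G : {group gT}) x y :
    Univ G = 1 ->
  darc (reduced_norm_digraph G) x y
    = [&& x \in G^#, y \in G^#, x != y & normalizes x y].
Proof.
move=> U1; rewrite /= /induced_arc /= U1 /norm_arc /= normalizingE.
by apply/and3P/and4P=> [[Gx Gy /and4P[]] | [Gx Gy ->]]; split=> //;
  have [[_ ->] [_ ->]] := (setD1P Gx, setD1P Gy).
Qed.

Theorem theoremC (gT : finGroupType) (G : {group gT})
    (solG : solvable G) (centerG : 'Z(G)%g = 1%g) :
  (strongly_connected (reduced_norm_digraph G) ->
     diameter (reduced_norm_digraph G) <= 8) /\
  (~~ strongly_connected (reduced_norm_digraph G) ->
     #|strong_components (reduced_norm_digraph G)| = #|'F(G)%g| + 1 /\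
     exists C : {set gT},
       [/\ C \in strong_components (reduced_norm_digraph G),
           diameter (induced (reduced_norm_digraph G) C) <= 6
         & forall C' : {set gT},
             C' \in strong_components (reduced_norm_digraph G) -> C' != C ->
             diameter (induced (reduced_norm_digraph G) C') <= 2]).
Proof.
have U1 := Univ_center_trivial centerG.
have defV := vertices_reducedE U1; have defE x y := @darc_reducedE _ G x y U1.
set D := reduced_norm_digraph G in defV defE *.
have [sFG nFG] := andP (Fitting_normal G).
have stepG : {in G^# &, forall x y, normalizes x y -> (x == y) || darc D x y}.
  by move=> x y Gx Gy nxy; rewrite defE Gx Gy nxy andbT orbN.
pose N := [set w in G^# | ~~ fixfree G w].
have sNG : N \subset G^# by apply/subsetP=> w; rewrite inE => /andP[].
have [linked | [H [K [y [defG Ky sKC regK [conjK closedK]]]]]] :=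
  fixfree_dichotomy solG.
  have linkG u : u \in G^# ->
      (exists2 f, f \in 'F(G)^# & walk (darc D) 3 u f) /\
      (exists2 f, f \in 'F(G)^# & walk (darc D) 3 f u).
    move=> Gu; have FG f : f \in 'F(G)^# -> f \in G^#.
      by apply: subsetP; rewrite setSD.
    have [ffu | nffu] := boolP (fixfree G u).
      have [[a [b [f [Ga Gb Ff /and3P[ua ab bf]]]]] [a' [b' [f' [Ga' Gb' Ff'
        /and3P[fb' ba' au']]]]]] := linked u Gu ffu.
      split; [exists f => // | exists f' => //].
        apply: walk_step (stepG u a Gu Ga ua) _;
          apply: walk_step (stepG a b Ga Gb ab) _.
        by apply: walk_step (stepG b f Gb (FG f Ff) bf) (walk_refl _ _ _).
      apply: walk_step (stepG f' b' (FG f' Ff') Gb' fb') _;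
        apply: walk_step (stepG b' a' Gb' Ga' ba') _.
      by apply: walk_step (stepG a' u Ga' Gu au') (walk_refl _ _ _).
    have Nu : u \in N by rewrite inE Gu.
    have [f Ff [uf fu]] := @not_fixfree_walk _ G _ (darc D) stepG sNG _ Nu.
    by split; exists f => //; [apply: (walk_trans (n :=
      1) uf) | apply: (walk_trans (n := 1) fu)]; apply: walk_refl.
  (* The bound is 3 steps to ['F(G)], 2 inside it, and 3 from it. *)
  have walkG : {in vertices D &, forall u v, walk (darc D) 8 u v}.
    rewrite defV => u v /linkG[[f Ff uf] _] /linkG[_ [f' Ff' fv]].
    apply: (walk_trans (m := 3) (n := 5) uf);
      apply: (walk_trans (m := 2) (n := 3) _ fv).
    exact: @Fitting_walk _ G _ (darc D) stepG sNG _ _ Ff Ff'.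
  split=> [_ | /negP[]]; first exact: diameter_le.
  by apply/forall_inP=> u Du; apply/forall_inP=> v Dv;
    apply: walk_connect (walkG u v Du Dv).
have [nty Ky'] := setD1P Ky; have [_ sHG _ nFH tiFH] := sdprod_context defG.
have sKH : K \subset H := subset_trans sKC (subsetIl _ _).
have sKG := subset_trans sKH sHG.
have Gf f : f \in 'F(G) -> f \in G by apply: subsetP.
have conjGf f x : f \in 'F(G) -> (x ^ f \in G^#) = (x \in G^#).
  by move/Gf=> Gf'; rewrite !inE conjg_eq1 groupJr.
have sKfG f : f \in 'F(G) -> K^# :^ f \subset G^#.
  by move=> Ff; apply/subsetP=> _ /imsetP[k Kk ->]; rewrite conjGf //;
    apply: subsetP k Kk; rewrite setSD.
have ffK f k : f \in 'F(G) -> k \in K^# :^ f -> fixfree G k.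
  move=> Ff /imsetP[{}k /setD1P[_ Kk] ->]; apply/fixfreeP.
  rewrite cycleJ -(normP (subsetP nFG f (Gf f Ff))); apply: semiregularJ.
  by apply: semiregularS regK; rewrite ?cycle_subG.
have coverK w : w \in G^# -> fixfree G w ->
  exists2 f, f \in 'F(G) & w \in K^# :^ f.
  move=> Gw ffw; have [f Ff Kwf] := conjK w Gw ffw; exists f^-1;
    first by rewrite groupV.
  by rewrite mem_conjgV; apply/setD1P; rewrite conjg_eq1; case/setD1P: Gw.
have closed f : f \in 'F(G) ->
    (forall u v, connect (darc D) u v -> u \in K^# :^ f -> v \in K^# :^ f) \/
    (forall u v, connect (darc D) u v -> v \in K^# :^ f -> u \in K^# :^ f).
  move=> Ff; have Ff' : f^-1 \in 'F(G) by rewrite groupV.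
  case: closedK => [outK | inK]; [left | right] => u v.
    apply: connect_out_closed => a b;
      rewrite defE !mem_conjg => /and4P[_ Gb _ nab] Ka.
    apply/setD1P; rewrite conjg_eq1; split; first by case/setD1P: Gb.
    by apply: outK Ka _ _; rewrite ?conjGf // normalizesJ.
  apply: connect_in_closed => a b;
    rewrite defE !mem_conjg => /and4P[Ga _ _ nab] Kb.
  apply/setD1P; rewrite conjg_eq1; split; first by case/setD1P: Ga.
  by apply: inK Kb _ _; rewrite ?conjGf // normalizesJ.
pose P := N |: [set K^# :^ f | f in 'F(G)].
have PP A : A \in P -> A = N \/ exists2 f, f \in 'F(G) & A = K^# :^ f.
  by case/setU1P=> [-> | /imsetP[f Ff ->]]; [left | right; exists f].
have stepA (A : {set gT}) : A \subset G^# ->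
    {in A &, forall x y, normalizes x y -> (x == y) || darc (induced D A) x y}.
  move=> sAG a b Aa Ab nab; apply/orP.
  have /orP[] := stepG a b (subsetP sAG a Aa) (subsetP sAG b Ab) nab;
    first by left.
  by move=> Dab; right; apply/and3P.
(* The bound 6 is 2 steps to ['F(G)], 2 inside it, and 2 from it, all within [N]. *)
have walkN : {in N &, forall u v, walk (darc (induced D N)) 6 u v}.
  move=> u v Nu Nv; have [f Ff [uf _]] :=
    @not_fixfree_walk _ G N (darc (induced D N)) (stepA N sNG) (subxx N) _ Nu.
  have [f' Ff' [_ fv]] := @not_fixfree_walk _ G N (darc (induced D N))
    (stepA N sNG) (subxx N) _ Nv.
  apply: (walk_trans (m := 2) (n := 4) uf);
    apply: (walk_trans (m := 2) (n := 2) _ fv).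
  exact: @Fitting_walk _ G N (darc (induced D N)) (stepA N sNG) (subxx N)
    _ _ Ff Ff'.
have walkK f : f \in 'F(G) ->
    {in K^# :^ f &, forall u v, walk (darc (induced D (K^# :^ f))) 2 u v}.
  move=> Ff u v Ku Kv; have step := stepA _ (sKfG f Ff).
  have Kyf : y ^ f \in K^# :^ f by rewrite memJ_conjg.
  have cyf x : x \in K^# :^ f -> x \in 'C[y ^ f].
    case/imsetP=> k /setD1P[_ Kk] ->; rewrite -conjg_set1 normJ memJ_conjg.
    by have /setIP[] := subsetP sKC k Kk.
  apply: walk_step (step _ _ Ku Kyf _) _;
    first by rewrite commute_normalizes // cent1C cyf.
  by apply: walk_step (step _ _ Kyf Kv _) (walk_refl _ 0 _);
    rewrite commute_normalizes ?cyf.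
have [f0 Ff0] : exists f, f \in 'F(G)^#.
  apply/set0Pn; rewrite setD_eq0 subG1 trivg_Fitting //.
  by apply/trivgPn; exists y; rewrite ?(subsetP sKG).
have Nf0 : f0 \in N := Fitting_not_fixfree Ff0.
have defP : strong_components D = P.
  apply: strong_componentsP =>
    [A /PP[-> | [f Ff ->]] | v | A a b /PP[-> | [f Ff ->]]].
  - split; first by apply/set0Pn; exists f0.
      by rewrite defV.
    apply/forall_inP=> u /setIP[_ Nu]; apply/forall_inP=> v /setIP[_ Nv].
    exact: walk_connect (walkN u v Nu Nv).
  - split; first by apply/set0Pn; exists (y ^ f); rewrite memJ_conjg.
      by rewrite defV sKfG.
    apply/forall_inP=> u /setIP[_ Ku]; apply/forall_inP=> v /setIP[_ Kv].
    exact: walk_connect (walkK f Ff u v Ku Kv).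
  - rewrite defV => Gv; have [ffv | nffv] := boolP (fixfree G v).
      have [f Ff Kv] := coverK v Gv ffv; exists (K^# :^ f) => //.
      by apply/setU1P; right; apply: imset_f.
    by exists N; rewrite ?setU11 // inE Gv.
  (* If [b] were fixfree it would lie in a conjugate of [K^#], closed in one direction; mutual
     reachability would put [a] there too, although [a] is not fixfree. *)
  - rewrite defV => Na Gb ab ba; rewrite inE Gb /=; apply/negP=> ffb.
    have [f Ff Kb] := coverK b Gb ffb; have : a \in K^# :^ f.
      by case: (closed f Ff) => closed_f;
        [apply: closed_f ba Kb | apply: closed_f ab Kb].
    by move/(ffK f a Ff); apply/negP; move: Na; rewrite inE => /andP[].
  move=> Ka _ ab ba.
  by case: (closed f Ff) => closed_f;
    [apply: closed_f ab Ka | apply: closed_f ba Ka].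
have notPN f : f \in 'F(G) -> N != K^# :^ f.
  move=> Ff; apply: contraTneq (Nf0) => ->; apply/negP=> /(ffK f f0 Ff);
    apply/negP.
  by move: Nf0; rewrite inE => /andP[].
(* Strong connectedness is impossible here: [K^#] is closed in one direction, contains [y] and
   misses [f0]. *)
split=> [scD | _].
  have Gf0 := subsetP sNG f0 Nf0.
  have Gy : y \in G^# by apply: (subsetP _ y Ky); rewrite setSD.
  have con u v : u \in G^# -> v \in G^# -> connect (darc D) u v.
    by rewrite -defV => Du Dv;
      have /forall_inP/(_ u Du)/forall_inP/(_ v Dv) := scD.
  have K1 : K^# :^ 1 = K^# by rewrite conjsg1.
  have : f0 \in K^# :^ 1.
    case: (closed 1 (group1 _)) => closed1;
      last by apply: closed1 (con f0 y _ _) _; rewrite ?K1.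
    by apply: closed1 (con y f0 _ _) _; rewrite ?K1.
  by move/(ffK 1 f0 (group1 _)) => ff0; move: Nf0; rewrite inE ff0 andbF.
rewrite defP; split.
  rewrite cardsU1 (_ : N \notin _) /=; last first.
    by apply/imsetP=> -[f Ff /eqP]; apply/negP/notPN.
  (* The conjugates of [K^#] are indexed injectively by ['F(G)]: if those by [f] and [g] agree,
     conjugation by [f * g^-1] keeps [y] in [H]. *)
  rewrite add1n addn1 card_in_imset // => f g Ff Fg eq_fg.
  have Kyfg : y ^ (f * g^-1) \in K.
    have : y ^ f \in K^# :^ g by rewrite -eq_fg memJ_conjg.
    by rewrite mem_conjg -conjgM => /setD1P[].
  apply/eqP; rewrite eq_mulgV1; apply/eqP.
  have Ffg : f * g^-1 \in 'F(G) by rewrite groupM ?groupV.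
  exact: complement_conj_eq1 defG (subsetP sKH y Ky') (regK y Ky)
    Ffg (subsetP sKH _ Kyfg).
exists N; split; first exact: setU11.
  by apply: diameter_le => u v /setIP[_ Nu] /setIP[_ Nv]; apply: walkN.
move=> C' /PP[-> | [f Ff ->] _]; first by rewrite eqxx.
by apply: diameter_le => u v /setIP[_ Ku] /setIP[_ Kv]; apply: walkK.
Qed.
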